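(* The variety of complex $3$-dimensional $\mathfrak{perm}$ superalgebras of type $(2,1)$ has dimension $4$ and has exactly $7$ irreducible components: $\overline{\mathcal{O}(\mathbf{R}_{01})},\ \overline{\mathcal{O}(\mathbf{R}_{02})},\ \overline{\mathcal{O}(\mathbf{R}_{04})},\ \overline{\mathcal{O}(\mathbf{R}_{10})},\ \overline{\mathcal{O}(\mathbf{R}_{25})},\ \overline{\mathcal{O}(\mathbf{R}_{31})},\ \overline{\mathcal{O}(\mathbf{R}_{33})}$. In particular, exactly $7$ superalgebras are rigid in this variety.
   Context: All algebras are over $\mathbb{C}$. A superalgebra is a $\mathbb{Z}_2$-graded algebra $A=A_0\oplus A_1$ with $A_iA_j\subseteq A_{i+j \bmod 2}$; $|x|\in\{0,1\}$ is the degree of a homogeneous $x$. It has type $(n,m)$ if $\dim A_0=n$, $\dim A_1=m$. The associator is $(x,y,z)=(xy)z-x(yz)$. A $\mathfrak{perm}$ superalgebra is a superalgebra satisfying $(x,y,z)=0$ and $x(yz)=(-1)^{|y||z|}x(zy)$ for all homogeneous $x,y,z$. Geometric setting: fix a graded space $V=V_0\oplus V_1$ of type $(n,m)$ with a homogeneous basis. Superalgebra structures on $V$ are even bilinear maps $\mu:V\times V\to V$, identified with their structure constants; those satisfying a given family of graded polynomial identities form a Zariski-closed subset (an affine variety) of this affine space. The group $GL(V_0)\times GL(V_1)$ acts by $(g*\mu)(x,y)=g\mu(g^{-1}x,g^{-1}y)$; its orbits are the isomorphism classes. $\mathcal{O}(A)$ denotes the orbit of (a structure representing) $A$ and $\overline{\mathcal{O}(A)}$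 its Zariski closure. A superalgebra is rigid if its orbit is open in the variety. The dimension of the variety is the maximal dimension of its irreducible components. Superalgebras of type $(2,1)$, in basis $e_1,e_2$ (even), $f_1$ (odd), listed by nonzero products (unlisted products are zero): $\mathbf{R}_{01}$: $e_1e_1=e_1,\ e_2e_2=e_2$; $\mathbf{R}_{02}$: $e_1e_1=e_1,\ e_2e_2=e_2,\ e_1f_1=f_1,\ f_1e_1=f_1$; $\mathbf{R}_{04}$: $e_1e_1=e_1,\ e_2e_2=e_2,\ f_1e_1=f_1$; $\mathbf{R}_{10}$: $e_1e_1=e_1,\ f_1f_1=e_2$; $\mathbf{R}_{25}$: $e_1e_1=e_1,\ e_2e_1=e_2$; $\mathbf{R}_{31}$: $e_1e_1=e_1,\ e_2e_1=e_2,\ f_1e_1=f_1$; $\mathbf{R}_{33}$: $e_1e_1=e_1,\ e_2e_1=e_2,\ e_1f_1=f_1,\ f_1e_1=f_1$. *)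

(* Defs.v *)
From HB Require Import structures.
From mathcomp Require Import all_boot all_order all_algebra.
From mathcomp Require Import complex.
From mathcomp Require Import Rstruct.
Set Implicit Arguments. Unset Strict Implicit. Unset Printing Implicit Defensive.
Import Order.TTheory GRing.Theory Num.Theory.
Local Open Scope ring_scope.

Definition C : numClosedFieldType := (Rdefinitions.R)[i].

(* Graded space V = V_0 (+) V_1 of type (2,1), homogeneous basis
   e1 = index 0, e2 = index 1 (even), f1 = index 2 (odd).
   Vectors are column vectors 'cV[C]_3. *)
Definition par (i : 'I_3) : bool := (i == 2 :> nat).

(* Structure constants: e_i e_j = \sum_k sc i j k e_k. *)
Definition sc := 'I_3 -> 'I_3 -> 'I_3 -> C.

Definition even_sc (c : sc) : Prop :=
  forall i j k, par k != (par i (+) par j) -> c i j k = 0.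

Definition mulv (c : sc) (x y : 'cV[C]_3) : 'cV[C]_3 :=
  \col_k (\sum_i \sum_j x i 0 * y j 0 * c i j k).

Definition homog (a : bool) (x : 'cV[C]_3) : Prop :=
  forall i, par i != a -> x i 0 = 0.

Definition perm_sc (c : sc) : Prop :=
  even_sc c /\
  forall (a b d : bool) (x y z : 'cV[C]_3),
    homog a x -> homog b y -> homog d z ->
    mulv c (mulv c x y) z = mulv c x (mulv c y z) /\
    mulv c x (mulv c y z) = (-1) ^+ (b && d) *: mulv c x (mulv c z y).

Definition permVar : sc -> Prop := perm_sc.

Inductive polyfun : (sc -> C) -> Prop :=
| pf_const (a : C) : polyfun (fun _ => a)
| pf_coord (i j k : 'I_3) : polyfun (fun c => c i j k)
| pf_add f g : polyfun f -> polyfun g -> polyfun (fun c => f c + g c)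
| pf_mul f g : polyfun f -> polyfun g -> polyfun (fun c => f c * g c).

Definition subsetS (Y Z : sc -> Prop) : Prop := forall c, Y c -> Z c.
Definition eqsetS (Y Z : sc -> Prop) : Prop := forall c, Y c <-> Z c.

Definition zclosed (Y : sc -> Prop) : Prop :=
  exists F : (sc -> C) -> Prop,
    (forall f, F f -> polyfun f) /\
    forall c, Y c <-> (even_sc c /\ forall f, F f -> f c = 0).

Definition zclosure (Y : sc -> Prop) : sc -> Prop :=
  fun c => forall Z, zclosed Z -> subsetS Y Z -> Z c.

Definition irreducible (Y : sc -> Prop) : Prop :=
  (exists c, Y c) /\
  forall Z1 Z2, zclosed Z1 -> zclosed Z2 ->
    subsetS Y (fun c => Z1 c \/ Z2 c) -> subsetS Y Z1 \/ subsetS Y Z2.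

Definition irr_component (X Y : sc -> Prop) : Prop :=
  zclosed Y /\ irreducible Y /\ subsetS Y X /\
  forall Y', irreducible Y' -> subsetS Y' X -> subsetS Y Y' -> subsetS Y' Y.

Definition irr_chain (Y : sc -> Prop) (n : nat) : Prop :=
  exists f : nat -> (sc -> Prop),
    (forall i, (i <= n)%N -> zclosed (f i) /\ irreducible (f i) /\ subsetS (f i) Y) /\
    (forall i, (i < n)%N -> subsetS (f i) (f i.+1) /\ ~ subsetS (f i.+1) (f i)).

Definition krull_dim (Y : sc -> Prop) (n : nat) : Prop :=
  irr_chain Y n /\ ~ irr_chain Y n.+1.

Definition var_dim (X : sc -> Prop) (n : nat) : Prop :=
  (forall Y, irr_component X Y -> exists m, (m <= n)%N /\ krull_dim Y m) /\
  (exists Y, irr_component X Y /\ krull_dim Y n).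

Definition even_mx (g : 'M[C]_3) : Prop :=
  forall i j : 'I_3, par i != par j -> g i j = 0.

Definition sorbit (c : sc) : sc -> Prop :=
  fun d => exists g : 'M[C]_3, g \in unitmx /\ even_mx g /\
    forall x y : 'cV[C]_3,
      mulv d x y = g *m mulv c (invmx g *m x) (invmx g *m y).

Definition rigid (X : sc -> Prop) (c : sc) : Prop :=
  X c /\ exists Z, zclosed Z /\ forall d, (X d /\ ~ sorbit c d) <-> (X d /\ Z d).

Definition sc_of (l : seq (nat * nat * nat)) : sc :=
  fun i j k => if ((i : nat), (j : nat), (k : nat)) \in l then 1 else 0.

(* e1 = 0, e2 = 1, f1 = 2 *)
Definition R01 : sc := sc_of [:: (0,0,0); (1,1,1)]%N.
Definition R02 : sc := sc_of [:: (0,0,0); (1,1,1); (0,2,2); (2,0,2)]%N.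
Definition R04 : sc := sc_of [:: (0,0,0); (1,1,1); (2,0,2)]%N.
Definition R10 : sc := sc_of [:: (0,0,0); (2,2,1)]%N.
Definition R25 : sc := sc_of [:: (0,0,0); (1,0,1)]%N.
Definition R31 : sc := sc_of [:: (0,0,0); (1,0,1); (2,0,2)]%N.
Definition R33 : sc := sc_of [:: (0,0,0); (1,0,1); (0,2,2); (2,0,2)]%N.

Definition Rlist : seq sc := [:: R01; R02; R04; R10; R25; R31; R33].
Definition Rk (i : 'I_7) : sc := nth R01 Rlist i.

(* Main.v *)
(** Each of the seven orbits lies in a polynomially parametrized family psi_i of perm structures,
    and every perm structure lies in one of the families.  The essential case is a commutative even
    part: there associativity says that a 2 x 3 matrix of structure constants has rank at most one,
    and splitting a binary quadratic form over C makes the two characters of the even part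
    polynomials in the parameters.

    Restricting to lines in the parameter space, a product of two polynomial functions vanishes
    identically only if one factor does; so each family is irreducible and is contained in the
    closure of the orbit it contains generically.  A few polynomials sep_i vanish on all the other
    families and, among perm structures, are not all zero exactly on the orbit of R_i: the orbits
    are open, and the closures are the irreducible components.

    For the dimension, a chain of d + 1 irreducible closed sets yields functions f_1, ..., f_d
    whose monomials are linearly independent.  Generically four parameters suffice, so for d = 5
    there would be N^5 independent monomials of degree O(N) in each of four variables, which is
    impossible since such polynomials are determined by their values on a grid of O(N^4) points. *)

Require Import Defs.
From mathcomp Require Import all_boot all_order all_algebra.
From mathcomp Require Import boolp ring.
Set Implicit Arguments. Unset Strict Implicit. Unset Printing Implicit Defensive.
Import Order.TTheory GRing.Theory Num.Theory.
Local Open Scope ring_scope.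
Opaque C.

(** * Polynomial functions on structure constants and on parameter spaces *)

Lemma polyfun_opp f : polyfun f -> polyfun (fun c => - f c).
Proof.
move=> pf.
have -> : (fun c => - f c) = (fun c => -1 * f c) by apply: funext => c; rewrite mulN1r.
by apply: pf_mul => //; apply: pf_const.
Qed.

Lemma polyfun_sub f g : polyfun f -> polyfun g -> polyfun (fun c => f c - g c).
Proof. by move=> pf pg; apply: pf_add => //; apply: polyfun_opp. Qed.

Lemma polyfun_sum (I : Type) (r : seq I) (F : I -> sc -> C) :
  (forall i, polyfun (F i)) -> polyfun (fun c => \sum_(i <- r) F i c).
Proof.
move=> pF; elim: r => [|i r IH].
  have -> : (fun c => \sum_(i <- [::]) F i c) = (fun=> 0).
    by apply: funext => c; rewrite big_nil.
  exact: pf_const.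
have -> : (fun c => \sum_(j <- i :: r) F j c)
        = (fun c => F i c + \sum_(j <- r) F j c).
  by apply: funext => c; rewrite big_cons.
exact: pf_add.
Qed.

Lemma polyfun_exp f n : polyfun f -> polyfun (fun c => f c ^+ n).
Proof.
move=> pf; elim: n => [|n IH].
  have -> : (fun c => f c ^+ 0) = (fun=> 1) by apply: funext => c; rewrite expr0.
  exact: pf_const.
have -> : (fun c => f c ^+ n.+1) = (fun c => f c * f c ^+ n).
  by apply: funext => c; rewrite exprS.
exact: pf_mul.
Qed.

(** The index type is left open: [psi] takes parameters indexed by [nat], so that all seven families
    share one parameter space, while [phi] takes ['I_4], where degrees and grid points are
    counted. *)
Inductive polyon (I : Type) : ((I -> C) -> C) -> Prop :=
| po_const (a : C) : polyon (fun _ => a)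
| po_coord (i : I) : polyon (fun p => p i)
| po_add f g : polyon f -> polyon g -> polyon (fun p => f p + g p)
| po_mul f g : polyon f -> polyon g -> polyon (fun p => f p * g p).

Lemma po_opp I (f : (I -> C) -> C) : polyon f -> polyon (fun p => - f p).
Proof.
move=> pf.
have -> : (fun p => - f p) = (fun p => -1 * f p) by apply: funext => c; rewrite mulN1r.
by apply: po_mul => //; apply: po_const.
Qed.

Definition family (I : Type) (psi : (I -> C) -> sc) : Prop :=
  forall i j k, polyon (fun p => psi p i j k).

Lemma polyfun_family I (psi : (I -> C) -> sc) F :
  family psi -> polyfun F -> polyon (fun p => F (psi p)).
Proof.
move=> fpsi; elim => {F} [a|i j k|f g _ pf _ pg|f g _ pf _ pg].
- exact: po_const.
- exact: fpsi.
- exact: (po_add pf pg).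
- exact: (po_mul pf pg).
Qed.

Lemma polyon_line I (f : (I -> C) -> C) (p q : I -> C) : polyon f ->
  exists P : {poly C}, forall t, f (fun i => p i + t * (q i - p i)) = P.[t].
Proof.
elim => {f} [a|i|f g _ [P fP] _ [Q gQ]|f g _ [P fP] _ [Q gQ]].
- by exists a%:P => t; rewrite hornerC.
- by exists ((p i)%:P + 'X * (q i - p i)%:P) => t; rewrite !hornerE.
- by exists (P + Q) => t; rewrite hornerD fP gQ.
- by exists (P * Q) => t; rewrite hornerM fP gQ.
Qed.

(** In characteristic zero the integers below [size P] are that many distinct roots. *)
Lemma poly_eq0_pointwise (P : {poly C}) : (forall t, P.[t] = 0) -> P = 0.
Proof.
move=> P0; apply: (@roots_geq_poly_eq0 _ _ [seq (i%:R : C) | i <- iota 0 (size P)]).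
- by apply/allP => x _; apply/rootP.
- by rewrite map_inj_uniq ?iota_uniq // => i j /eqP; rewrite eqr_nat => /eqP.
- by rewrite size_map size_iota.
Qed.

(* Two points at which f, resp. g, does not vanish lie on a line, and {poly C} is a domain. *)
Lemma polyon_domain I (f g : (I -> C) -> C) : polyon f -> polyon g ->
  (forall p, f p * g p = 0) -> (forall p, f p = 0) \/ (forall p, g p = 0).
Proof.
move=> pf pg fg0; case: (pselect (forall p, f p = 0)) => [|/existsNP[p fp]]; first by left.
right => q; apply: contrapT => gq.
have [P fP] := polyon_line p q pf; have [Q gQ] := polyon_line p q pg.
have /eqP : P * Q = 0.
  by apply: poly_eq0_pointwise => t; rewrite hornerM -fP -gQ fg0.
rewrite mulf_eq0 => /orP[] /eqP h0.
- apply: fp; have := fP 0; rewrite h0 horner0 => <-; congr f.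
  by apply: funext => i; rewrite mul0r addr0.
- apply: gq; have := gQ 1; rewrite h0 horner0 => <-; congr g.
  by apply: funext => i; rewrite mul1r addrC subrK.
Qed.

(** * Zariski closure and irreducible sets *)

Definition vanishes (Y : sc -> Prop) (f : sc -> C) := forall c, Y c -> f c = 0.

(** The common zero set of all polynomial functions vanishing on Y is closed and contains Y; every
    closed set containing Y is cut out by such functions. *)
Lemma zclosureP Y c : (forall d, Y d -> even_sc d) ->
  zclosure Y c <-> even_sc c /\ forall f, polyfun f -> vanishes Y f -> f c = 0.
Proof.
move=> eY; split=> [cY|[ec vc] Z [F [pF ZF]] YZ].
  apply: (cY (fun c => even_sc c /\ forall f, polyfun f -> vanishes Y f -> f c = 0)).
    exists (fun f => polyfun f /\ vanishes Y f); split=> [f []//|d].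
    split=> -[ed vd]; split=> // f; first by case=> pf vf; apply: vd.
    by move=> pf vf; apply: vd.
  by move=> d Yd; split; [exact: eY|move=> f _; apply].
apply/ZF; split=> // f Ff; apply: vc; first exact: pF.
by move=> d /YZ /ZF[_]; apply.
Qed.

Lemma zclosure_closed Y : (forall d, Y d -> even_sc d) -> zclosed (zclosure Y).
Proof.
move=> eY; exists (fun f => polyfun f /\ vanishes Y f); split=> [f []//|c].
rewrite zclosureP //; split=> -[ec vc]; split=> // f; first by case=> pf vf; apply: vc.
by move=> pf vf; apply: vc.
Qed.

Lemma sub_zclosure Y : subsetS Y (zclosure Y).
Proof. by move=> c Yc Z _; apply. Qed.

Lemma zclosure_min Y Z : zclosed Z -> subsetS Y Z -> subsetS (zclosure Y) Z.
Proof. by move=> cZ YZ c; apply. Qed.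

Lemma irreducible_eqset Y Z : eqsetS Y Z -> irreducible Z -> irreducible Y.
Proof.
by move=> /(fun h c => propext (h c))/funext ->.
Qed.

Lemma irreducible_zclosure Y : irreducible Y -> irreducible (zclosure Y).
Proof.
move=> [[c Yc] irr]; split; first by exists c; exact: sub_zclosure.
move=> Z1 Z2 cZ1 cZ2 sub.
have [h|h] : subsetS Y Z1 \/ subsetS Y Z2 by apply: irr => // d /sub_zclosure /sub.
- by left; apply: zclosure_min.
- by right; apply: zclosure_min.
Qed.

Definition img (I : Type) (psi : (I -> C) -> sc) : sc -> Prop :=
  fun c => exists p, c = psi p.

(** If the image is not inside Z1, some equation f of Z1 is nonzero somewhere. Its product with any
    equation g of Z2 vanishes on the whole parameter space, so g does. *)
Lemma irreducible_img I (psi : (I -> C) -> sc) :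
  family psi -> (forall p, even_sc (psi p)) -> irreducible (img psi).
Proof.
move=> fpsi epsi; split; first by exists (psi (fun=> 0)), (fun=> 0).
move=> Z1 Z2 [F1 [pF1 ZF1]] [F2 [pF2 ZF2]] sub.
case: (pselect (subsetS (img psi) Z1)) => [|/existsNP[c /not_implyP[[p ->]]]]; first by left.
rewrite ZF1 => /not_andP[/(_ (epsi p))//|/existsNP[f /not_implyP[F1f fp]]].
right => _ [q ->]; apply/ZF2; split=> [|g F2g]; first exact: epsi.
have [||] := polyon_domain (polyfun_family fpsi (pF1 _ F1f)) (polyfun_family fpsi (pF2 _ F2g)).
- move=> u; have [|/ZF1[_ h]|/ZF2[_ h]] := sub (psi u); first by exists u.
    by rewrite (h _ F1f) mul0r.
  by rewrite (h _ F2g) mulr0.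
- by move=> f0; case: fp.
- exact.
Qed.

(** The vanishing ideal of an irreducible set is prime: Y is covered by the zero sets of f and g. *)
Lemma irreducible_vanishes_mul Y f g : irreducible Y -> (forall c, Y c -> even_sc c) ->
  polyfun f -> polyfun g -> vanishes Y (fun c => f c * g c) -> vanishes Y f \/ vanishes Y g.
Proof.
move=> [_ irr] eY pf pg fg0.
have cl h : polyfun h -> zclosed (fun c => even_sc c /\ h c = 0).
  move=> ph; exists (fun h' => h' = h); split=> [_ -> //|c].
  by split=> -[ec hc]; split=> //; [move=> _ ->|apply: hc].
have [|h|h] := irr _ _ (cl f pf) (cl g pg).
- move=> c Yc; move/eqP: (fg0 c Yc); rewrite mulf_eq0 => /orP[]/eqP hc.
    by left; split=> //; exact: eY.
  by right; split=> //; exact: eY.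
- by left=> c /h[].
- by right=> c /h[].
Qed.

Lemma polyfun_prod (I : Type) (r : seq I) (F : I -> sc -> C) :
  (forall i, polyfun (F i)) -> polyfun (fun c => \prod_(i <- r) F i c).
Proof.
move=> pF; elim: r => [|i r IH].
  have -> : (fun c => \prod_(i <- [::]) F i c) = (fun=> 1).
    by apply: funext => c; rewrite big_nil.
  exact: pf_const.
have -> : (fun c => \prod_(j <- i :: r) F j c)
        = (fun c => F i c * \prod_(j <- r) F j c).
  by apply: funext => c; rewrite big_cons.
exact: pf_mul.
Qed.

Lemma irreducible_vanishes_prod (I : Type) (r : seq I) (F : I -> sc -> C) Y :
  irreducible Y -> (forall c, Y c -> even_sc c) -> (forall i, polyfun (F i)) ->
  vanishes Y (fun c => \prod_(i <- r) F i c) -> exists i, vanishes Y (F i).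
Proof.
move=> irr eY pF; elim: r => [|i r IH] van.
  case: irr => [[c Yc] _]; have := van c Yc.
  by rewrite big_nil => /eqP; rewrite oner_eq0.
have [||h|h] := @irreducible_vanishes_mul Y (F i) (fun c => \prod_(j <- r) F j c) irr eY (pF i).
- exact: polyfun_prod.
- by move=> c Yc; have := van c Yc; rewrite big_cons.
- by exists i.
- exact: IH.
Qed.

Lemma zclosed_even Y c : zclosed Y -> Y c -> even_sc c.
Proof. by move=> [F [_ ->]] []. Qed.

(** * An upper bound for the length of chains *)

Definition lin_indep (W : sc -> Prop) (I : finType) (g : I -> sc -> C) :=
  forall a : I -> C, vanishes W (fun c => \sum_i a i * g i c) -> forall i, a i = 0.

(** Take a relation on W' and order it by powers of f. On W only the constant term survives, so its
    coefficients are zero; the rest is divisible by f, which cancels by irreducibility of W'. Then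
    induct. *)
Lemma lin_indep_powers (W W' : sc -> Prop) (f : sc -> C) (I : finType) (g : I -> sc -> C) N :
  subsetS W W' -> irreducible W' -> (forall c, W' c -> even_sc c) ->
  polyfun f -> vanishes W f -> ~ vanishes W' f ->
  (forall i, polyfun (g i)) -> lin_indep W g ->
  lin_indep W' (fun (ij : I * 'I_N) c => g ij.1 c * f c ^+ ij.2).
Proof.
move=> WW' irr eW' pf fW fW' pg indep.
have key n : forall a : nat -> I -> C,
    vanishes W' (fun c => \sum_(j < n) (\sum_i a j i * g i c) * f c ^+ j) ->
    forall j, (j < n)%N -> forall i, a j i = 0.
  elim: n => [//|n IH] a van.
  have a0 : forall i, a 0%N i = 0.
    apply: indep => c Wc; have := van c (WW' _ Wc).
    rewrite big_ord_recl /= expr0 mulr1 => h; rewrite -[RHS]h -[LHS]addr0.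
    congr (_ + _); symmetry; apply: big1 => j _.
    by rewrite fW // exprS mul0r mulr0.
  have van' : vanishes W' (fun c => f c * \sum_(j < n) (\sum_i a j.+1 i * g i c) * f c ^+ j).
    move=> c W'c; rewrite -[RHS](van c W'c) big_ord_recl /=.
    have -> : \sum_i a 0%N i * g i c = 0 by apply: big1 => i _; rewrite a0 mul0r.
    rewrite mul0r add0r mulr_sumr; apply: eq_bigr => j _.
    by rewrite exprS mulrCA.
  have {van'} [|//|van'] := irreducible_vanishes_mul irr eW' pf _ van'.
    apply: polyfun_sum => j; apply: pf_mul; last exact: polyfun_exp.
    by apply: polyfun_sum => i; apply: pf_mul => //; apply: pf_const.
  by case=> // j; rewrite ltnS; exact: (IH (fun j => a j.+1)).
move=> a van [i j].
pose b n i := if insub n is Some j then a (i, j) else 0.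
have -> : a (i, j) = b j i by rewrite /b valK.
apply: (key N) => // c W'c; rewrite -[RHS](van c W'c).
rewrite [RHS](eq_bigr (fun ij => a (ij.1, ij.2) * (g ij.1 c * f c ^+ ij.2))); last by case.
rewrite -(pair_bigA _ (fun i j => a (i, j) * (g i c * f c ^+ j))) exchange_big /=.
apply: eq_bigr => k _; rewrite mulr_suml; apply: eq_bigr => l _.
by rewrite /b valK mulrA.
Qed.

Definition upd (n : nat) (p : 'I_n -> C) (i : 'I_n) (t : C) : 'I_n -> C :=
  fun j => if j == i then t else p j.

(** Degree at most M in each variable separately, tested on lines parallel to the axes; [size] is
    degree plus one. *)
Definition degle (n : nat) (f : ('I_n -> C) -> C) (M : nat) :=
  forall p i, exists P : {poly C}, (size P <= M.+1)%N /\ forall t, f (upd p i t) = P.[t].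

Lemma degle_const n (a : C) M : degle (fun _ : 'I_n -> C => a) M.
Proof.
by move=> p i; exists a%:P; split=> [|t]; rewrite ?hornerC // (leq_trans (size_polyC_leq1 _)).
Qed.

Lemma degle_add n (f g : ('I_n -> C) -> C) M :
  degle f M -> degle g M -> degle (fun p => f p + g p) M.
Proof.
move=> df dg p i; have [P [sP fP]] := df p i; have [Q [sQ gQ]] := dg p i.
exists (P + Q); split=> [|t]; last by rewrite hornerD fP gQ.
by rewrite (leq_trans (size_polyD _ _)) // geq_max sP.
Qed.

Lemma degle_mul n (f g : ('I_n -> C) -> C) M N :
  degle f M -> degle g N -> degle (fun p => f p * g p) (M + N).
Proof.
move=> df dg p i; have [P [sP fP]] := df p i; have [Q [sQ gQ]] := dg p i.
exists (P * Q); split=> [|t]; last by rewrite hornerM fP gQ.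
rewrite (leq_trans (size_polyMleq _ _)) // -subn1 leq_subLR add1n -addnS.
by rewrite -addSn leq_add.
Qed.

Lemma degle_leq n (f : ('I_n -> C) -> C) M N : (M <= N)%N -> degle f M -> degle f N.
Proof.
move=> MN df p i; have [P [sP fP]] := df p i.
by exists P; split=> //; apply: leq_trans sP _.
Qed.

Lemma degle_exp n (f : ('I_n -> C) -> C) M k :
  degle f M -> degle (fun p => f p ^+ k) (M * k).
Proof.
move=> df; elim: k => [|k IH].
  have -> : (fun p => f p ^+ 0) = (fun=> 1) by apply: funext => p; rewrite expr0.
  exact: degle_const.
have -> : (fun p => f p ^+ k.+1) = (fun p => f p * f p ^+ k).
  by apply: funext => p; rewrite exprS.
by rewrite mulnS; apply: degle_mul.
Qed.

Lemma degle_sum n (I : Type) (r : seq I) (F : I -> ('I_n -> C) -> C) M :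
  (forall i, degle (F i) M) -> degle (fun p => \sum_(i <- r) F i p) M.
Proof.
move=> dF; elim: r => [|i r IH].
  have -> : (fun p => \sum_(i <- [::]) F i p) = (fun=> 0).
    by apply: funext => p; rewrite big_nil.
  exact: degle_const.
have -> : (fun p => \sum_(j <- i :: r) F j p)
        = (fun p => F i p + \sum_(j <- r) F j p).
  by apply: funext => p; rewrite big_cons.
exact: degle_add.
Qed.

Lemma polyon_degle n (f : ('I_n -> C) -> C) : polyon f -> exists M, degle f M.
Proof.
elim => {f} [a|i|f g _ [M df] _ [N dg]|f g _ [M df] _ [N dg]].
- by exists 0%N; apply: degle_const.
- exists 1%N => p j; case: (eqVneq i j) => [->|ij].
    by exists 'X; split=> [|t]; rewrite ?size_polyX // hornerX /upd eqxx.
  exists (p i)%:P; split=> [|t]; first by rewrite (leq_trans (size_polyC_leq1 _)).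
  by rewrite hornerC /upd (negbTE ij).
- exists (M + N)%N; apply: degle_add.
    by apply: degle_leq df; rewrite leq_addr.
  by apply: degle_leq dg; rewrite leq_addl.
- by exists (M + N)%N; apply: degle_mul.
Qed.

(** The variables are freed from the grid one at a time: freeing one leaves a univariate polynomial
    of degree at most M with M + 1 zeros. *)
Lemma degle_grid_eq0 n (f : ('I_n -> C) -> C) M : degle f M ->
  (forall s : {ffun 'I_n -> 'I_M.+1}, f (fun i => (s i)%:R) = 0) -> forall p, f p = 0.
Proof.
move=> df f0.
have key k : (k <= n)%N -> forall p : 'I_n -> C,
    (forall i : 'I_n, (k <= i)%N -> exists m : 'I_M.+1, p i = m%:R) -> f p = 0.
  elim: k => [|k IH] lekn p grid.
    have [s ps] := fin_all_exists (fun i => grid i (leq0n i)).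
    rewrite -(f0 (finfun s)); congr f; apply: funext => i.
    by rewrite ffunE ps.
  pose i0 := Ordinal lekn; have [P [sP fP]] := df p i0.
  have -> : p = upd p i0 (p i0).
    by apply: funext => j; rewrite /upd; case: eqP => // ->.
  rewrite fP; suff -> : P = 0 by rewrite horner0.
  apply: (@roots_geq_poly_eq0 _ _ [seq (i%:R : C) | i <- iota 0 M.+1]).
  - apply/allP => x /mapP[m]; rewrite mem_iota add0n => /andP[_ mM] ->.
    apply/rootP; rewrite -fP; apply: IH; first exact: ltnW.
    move=> j lekj; rewrite /upd; case: eqP => [_|/eqP jk]; first by exists (Ordinal mM).
    by apply: grid; rewrite ltn_neqAle lekj andbT; apply: contra jk => /eqP kj; apply/eqP/val_inj.
  - by rewrite map_inj_uniq ?iota_uniq // => i j /eqP; rewrite eqr_nat => /eqP.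
  - by rewrite size_map size_iota.
by move=> p; apply: (key n) => // i; rewrite leqNgt ltn_ord.
Qed.

Lemma dep_row (m n : nat) (A : 'M[C]_(m, n)) : (n < m)%N ->
  exists2 v : 'rV[C]_m, v != 0 & v *m A = 0.
Proof.
move=> nm; have : kermx A != 0.
  rewrite kermx_eq0 -row_leq_rank -ltnNge.
  exact: leq_ltn_trans (rank_leq_col A) nm.
by move=> /rowV0Pn[v /sub_kermxP vA v0]; exists v.
Qed.

(** Each strict inclusion supplies an equation of the smaller set that does not vanish on the larger
    one; its powers below N multiply the number of independent functions by N. K, a sum of degree
    bounds, is fixed before N. *)
Lemma chain_indep n (phi : ('I_n -> C) -> sc) (f : nat -> sc -> Prop) d : family phi ->
  (forall i, (i <= d)%N -> zclosed (f i) /\ irreducible (f i)) ->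
  (forall i, (i < d)%N -> subsetS (f i) (f i.+1) /\ ~ subsetS (f i.+1) (f i)) ->
  exists K, forall N, exists (I : finType) (g : I -> sc -> C),
    [/\ #|I| = (N ^ d)%N, lin_indep (f d) g, forall i, polyfun (g i)
      & forall i, degle (fun p => g i (phi p)) (K * N)].
Proof.
move=> fphi; elim: d => [|d IH] cl ch.
  exists 0%N => N; exists unit, (fun _ _ => 1); split.
  - by rewrite card_unit expn0.
  - move=> a van; case; have [_ [[c fc] _]] := cl 0%N (leqnn _).
    by have := van c fc; rewrite (big_pred1 tt) ?mulr1 // => -[].
  - by move=> _; apply: pf_const.
  - by move=> _; apply: degle_const.
have [K HK] := IH (fun i h => cl i (leqW h)) (fun i h => ch i (leqW h)).
have [sub nsub] := ch d (leqnn _).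
have [cd _] := cl d (leqnSn _); have [cd1 irr1] := cl d.+1 (leqnn _).
have [h [ph van nvan]] : exists h, [/\ polyfun h, vanishes (f d) h & ~ vanishes (f d.+1) h].
  case: (cd) => F [pF fF].
  have /existsNP[c /not_implyP[f1c]] := nsub.
  rewrite fF => /not_andP[/(_ (zclosed_even cd1 f1c))//|/existsNP[h /not_implyP[Fh hc]]].
  exists h; split; first exact: pF.
    by move=> e /fF[_]; apply.
  by move=> /(_ _ f1c).
have [e de] := polyon_degle (polyfun_family fphi ph).
exists (K + e)%N => N; have [I [g [cI indep pg dg]]] := HK N.
exists (I * 'I_N)%type, (fun (ij : I * 'I_N) c => g ij.1 c * h c ^+ ij.2); split.
- by rewrite card_prod cI card_ord expnSr.
- by apply: (lin_indep_powers (W := f d)) => // c; apply: zclosed_even.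
- by move=> ij; apply: pf_mul => //; apply: polyfun_exp.
- move=> [i j]; rewrite mulnDl; apply: degle_mul => //=.
  by apply: degle_leq (degle_exp _ de); rewrite leq_mul2l ltnW ?orbT.
Qed.

(* N^(n+1) independent functions of degree at most KN in each of n variables
   would be determined by their values on the (KN+1)^n points of a grid. *)
Lemma no_long_chain n (phi : ('I_n -> C) -> sc) (Y : sc -> Prop) : family phi ->
  (forall g, polyfun g -> (forall p, g (phi p) = 0) -> vanishes Y g) ->
  ~ irr_chain Y n.+1.
Proof.
move=> fphi dense [f [cl ch]].
have [K HK] := chain_indep fphi (fun i h => conj (proj1 (cl i h)) (proj1 (proj2 (cl i h)))) ch.
(* This N makes N^(n+1) exceed ((K+1)N)^n, which bounds the number (KN+1)^n of grid points. *)
pose N := (K.+1 ^ n).+1; have [I [g [cI indep pg dg]]] := HK N.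
pose G := {ffun 'I_n -> 'I_(K * N).+1}.
pose pt (s : G) : 'I_n -> C := fun i => (s i)%:R.
pose A : 'M[C]_(#|I|, #|G|) := \matrix_(i, s) g (enum_val i) (phi (pt (enum_val s))).
(* There are more functions than grid points, so a nontrivial combination vanishes on the grid,
   hence along [phi], hence on Y. *)
have [|v v0 vA] := dep_row A.
  rewrite cI card_ffun !card_ord; apply: (@leq_ltn_trans ((K.+1 * N) ^ n)%N).
    by case: (n) => // k; rewrite leq_exp2r // mulSn addSn ltnS leq_addl.
  by rewrite expnMn expnS ltn_mul2r expn_gt0 /= ltnSn.
case/negP: v0; apply/eqP/rowP => i; rewrite mxE.
have := indep (fun x => v 0 (enum_rank x)) _ (enum_val i); rewrite enum_valK; apply.
have -> : (fun c => \sum_x v 0 (enum_rank x) * g x c) =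
          (fun c => \sum_i v 0 i * g (enum_val i) c).
  apply: funext => c; rewrite (reindex (@enum_val I xpredT)) /=.
    by apply: eq_bigr => j _; rewrite enum_valK.
  by exists enum_rank => x _; rewrite ?enum_valK ?enum_rankK.
have sub := proj2 (proj2 (cl _ (leqnn _))).
move=> c /sub; move: c; apply: (dense (fun c => \sum_i v 0 i * g (enum_val i) c)).
  by apply: polyfun_sum => j; apply: pf_mul => //; apply: pf_const.
apply: (@degle_grid_eq0 _ (fun p => \sum_i v 0 i * g (enum_val i) (phi p)) (K * N)).
  apply: degle_sum => j; rewrite -[(K * N)%N]add0n; apply: degle_mul => //.
  exact: degle_const.
move=> s; move/rowP/(_ (enum_rank s)): vA; rewrite !mxE => vs; rewrite -[RHS]vs.
by apply: eq_bigr => j _; rewrite ?mxE enum_rankK.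
Qed.

(** * Structure constants and isomorphisms *)

Definition o0 : 'I_3 := @Ordinal 3 0 isT.
Definition o1 : 'I_3 := @Ordinal 3 1 isT.
Definition o2 : 'I_3 := @Ordinal 3 2 isT.

Lemma ord3P (P : 'I_3 -> Prop) : P o0 -> P o1 -> P o2 -> forall i, P i.
Proof.
move=> P0 P1 P2 [[|[|[|//]]] lti].
- by rewrite (_ : Ordinal lti = o0) //; apply: val_inj.
- by rewrite (_ : Ordinal lti = o1) //; apply: val_inj.
- by rewrite (_ : Ordinal lti = o2) //; apply: val_inj.
Qed.

Lemma sum3 (F : 'I_3 -> C) : \sum_i F i = F o0 + F o1 + F o2.
Proof.
rewrite !big_ord_recl big_ord0 addr0 addrA.
by congr (F _ + F _ + F _); apply: val_inj.
Qed.

Lemma sc_ext (c d : sc) : (forall i j k, c i j k = d i j k) -> c = d.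
Proof.
by move=> cd; apply: funext => i; apply: funext => j; apply: funext => k.
Qed.

Lemma mulv_delta c i j : mulv c (delta_mx i 0) (delta_mx j 0) = \col_k c i j k.
Proof.
apply/matrixP => k z; rewrite !mxE (bigD1 i) //= (bigD1 j) //= !mxE !eqxx.
rewrite !mul1r !big1 ?addr0 // => [i' ne|j' ne].
  by rewrite big1 // => j' _; rewrite !mxE (negbTE ne) !mul0r.
by rewrite !mxE (negbTE ne) mulr0 mul0r.
Qed.

Lemma mulv_col_delta c (u : 'I_3 -> C) l :
  mulv c (\col_m u m) (delta_mx l 0) = \col_k \sum_m u m * c m l k.
Proof.
apply/matrixP => k z; rewrite !mxE; apply: eq_bigr => m _.
rewrite (bigD1 l) //= !mxE !eqxx mulr1 big1 ?addr0 // => l' ne.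
by rewrite !mxE (negbTE ne) mulr0 mul0r.
Qed.

Lemma mulv_delta_col c (u : 'I_3 -> C) i :
  mulv c (delta_mx i 0) (\col_m u m) = \col_k \sum_m u m * c i m k.
Proof.
apply/matrixP => k z; rewrite !mxE (bigD1 i) //= [X in _ + X]big1 ?addr0.
  by apply: eq_bigr => m _; rewrite !mxE !eqxx mul1r.
move=> i' ne; apply: big1 => j' _.
by rewrite !mxE (negbTE ne) !mul0r.
Qed.

Lemma mulvA_l c x y z k : mulv c (mulv c x y) z k 0 =
  \sum_i \sum_j \sum_l x i 0 * y j 0 * z l 0 * \sum_m c i j m * c m l k.
Proof. by rewrite !mxE !sum3 !mxE !sum3; ring. Qed.

Lemma mulvA_r c x y z k : mulv c x (mulv c y z) k 0 =
  \sum_i \sum_j \sum_l x i 0 * y j 0 * z l 0 * \sum_m c j l m * c i m k.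
Proof. by rewrite !mxE !sum3 !mxE !sum3; ring. Qed.

Definition perm_basis (c : sc) (i j l k : 'I_3) : Prop :=
  \sum_m c i j m * c m l k = \sum_m c j l m * c i m k /\
  \sum_m c j l m * c i m k = (-1) ^+ (par j && par l) * \sum_m c l j m * c i m k.

Lemma homog_delta i : homog (par i) (delta_mx i 0).
Proof.
move=> j ji; rewrite mxE; case: eqP => [e|//].
by move: ji; rewrite e eqxx.
Qed.

(** Both identities are trilinear, so basis vectors suffice. For homogeneous vectors a coordinate
    product is zero unless the indices have the parities of the vectors, so the signs agree. *)
Lemma permVarP c : permVar c <-> even_sc c /\ forall i j l k, perm_basis c i j l k.
Proof.
split=> [[ec pc]|[ec pc]]; split=> //.
  move=> i j l k.
  have [as_ pe] := pc _ _ _ _ _ _ (@homog_delta i) (@homog_delta j) (@homog_delta l).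
  move: as_ pe; rewrite !mulv_delta mulv_col_delta !mulv_delta_col => as_ pe.
  by split; [move/colP/(_ k): as_|move/colP/(_ k): pe]; rewrite !mxE.
move=> a b d x y z hx hy hz.
have hom0 i j l : [/\ par i = a, par j = b & par l = d] \/ x i 0 * y j 0 * z l 0 = 0.
  case: (eqVneq (par i) a) => [<-|/hx ->]; last by right; rewrite !mul0r.
  case: (eqVneq (par j) b) => [<-|/hy ->]; last by right; rewrite mulr0 mul0r.
  by case: (eqVneq (par l) d) => [<-|/hz ->]; [left|right; rewrite mulr0].
split; apply/colP => k; rewrite ?mulvA_l ?mulvA_r.
  apply: eq_bigr => i _; apply: eq_bigr => j _; apply: eq_bigr => l _.
  by case: (pc i j l k) => -> _.
rewrite mxE mulvA_r mulr_sumr; apply: eq_bigr => i _.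
rewrite [in RHS]exchange_big /= mulr_sumr.
apply: eq_bigr => j _; rewrite mulr_sumr; apply: eq_bigr => l _.
rewrite [x i 0 * z l 0 * _]mulrAC.
case: (hom0 i j l) => [[_ <- <-]|->]; last by rewrite !mul0r mulr0.
by case: (pc i j l k) => _ ->; rewrite mulrCA.
Qed.

Lemma permVar_closed : zclosed permVar.
Proof.
exists (fun f => exists i j l k,
  f = (fun c => \sum_m c i j m * c m l k - \sum_m c j l m * c i m k) \/
  f = (fun c => \sum_m c j l m * c i m k -
                (-1) ^+ (par j && par l) * \sum_m c l j m * c i m k)).
split=> [f [i [j [l [k [->|->]]]]]|c].
- by apply: polyfun_sub; apply: polyfun_sum => m; apply: pf_mul; apply: pf_coord.
- apply: polyfun_sub; last (apply: pf_mul; first exact: pf_const);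
  by apply: polyfun_sum => m; apply: pf_mul; apply: pf_coord.
rewrite permVarP; split=> -[ec pc]; split=> //.
  move=> f [i [j [l [k [->|->]]]]]; case: (pc i j l k) => e1 e2.
    by rewrite e1 subrr.
  by rewrite e2 subrr.
move=> i j l k; split; apply/eqP; rewrite -subr_eq0; apply/eqP.
  by apply: (pc (fun c => _ - _)); exists i, j, l, k; left.
by apply: (pc (fun c => _ - _)); exists i, j, l, k; right.
Qed.

(** Invertibility and evenness are stated separately, so that the identity can be checked uniformly
    over a family, singular matrices included. *)
Definition isom (h : 'M[C]_3) (c d : sc) : Prop :=
  forall x y, h *m mulv c x y = mulv d (h *m x) (h *m y).

Definition hom_basis (h : 'M[C]_3) (c d : sc) (i j k : 'I_3) : Prop :=
  \sum_l h k l * c i j l = \sum_i' \sum_j' h i' i * h j' j * d i' j' k.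

Lemma isomP h c d : isom h c d <-> forall i j k, hom_basis h c d i j k.
Proof.
split=> hc.
  move=> i j k; have := hc (delta_mx i 0) (delta_mx j 0).
  rewrite mulv_delta -!colE => /colP/(_ k); rewrite !mxE => e.
  transitivity (\sum_l h k l * (\col_k0 c i j k0) l (0 : 'I_1)).
    by apply: eq_bigr => l _; rewrite mxE.
  rewrite e; apply: eq_bigr => i' _; apply: eq_bigr => j' _.
  by rewrite !mxE.
move=> x y; apply/colP => k; rewrite !mxE.
transitivity (\sum_i \sum_j x i 0 * y j 0 * \sum_l h k l * c i j l).
  by rewrite !sum3 !mxE !sum3; ring.
rewrite (eq_bigr (fun i => \sum_j x i 0 * y j 0 *
           (\sum_i' \sum_j' h i' i * h j' j * d i' j' k))); last first.
  by move=> i _; apply: eq_bigr => j _; rewrite -(hc i j k).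
by rewrite !sum3 !mxE !sum3; ring.
Qed.

Lemma double_eq0 (u : C) : u + u = 0 -> u = 0.
Proof. by rewrite -mulr2n => /eqP; rewrite mulrn_eq0 => /eqP. Qed.

(** The parity involution. Even matrices are those commuting with it, which gives stability under
    products and inverses at once. *)
Definition parsign : 'rV[C]_3 := \row_i (-1) ^+ par i.

Lemma even_mx_comm g : even_mx g <-> diag_mx parsign *m g = g *m diag_mx parsign.
Proof.
split=> [eg|/matrixP comm i j].
  apply/matrixP => i j; rewrite mul_diag_mx mul_mx_diag !mxE mulrC.
  by case: (eqVneq (par i) (par j)) => [->|/eg ->]; rewrite ?mul0r.
move: (comm i j); rewrite mul_diag_mx mul_mx_diag !mxE.
case: (par i) (par j) => -[] //= e _; apply: double_eq0.
- by rewrite -[X in X + _]mulr1 -e mulN1r addNr.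
- by rewrite -[X in X + _]mul1r e mulrN1 addNr.
Qed.

Lemma even_invmx g : g \in unitmx -> even_mx g -> even_mx (invmx g).
Proof.
move=> ug /even_mx_comm comm; apply/even_mx_comm.
rewrite -[LHS]mul1mx -{1}(mulVmx ug) -!mulmxA; congr (_ *m _).
by rewrite mulmxA -comm -mulmxA mulmxV // mulmx1.
Qed.

(** The matrix h is the inverse of the acting one, so that the canonical form d is the target. *)
Lemma sorbitP d c : sorbit d c <-> exists h, [/\ h \in unitmx, even_mx h & isom h c d].
Proof.
split=> [[g [ug [eg gc]]]|[h [uh eh hc]]].
  exists (invmx g); rewrite unitmx_inv; split=> //; first exact: even_invmx.
  by move=> x y; rewrite gc mulmxA mulVmx // mul1mx.
exists (invmx h); rewrite unitmx_inv; split=> //; split; first exact: even_invmx.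
by move=> x y; rewrite invmxK -hc mulmxA mulVmx // mul1mx.
Qed.

Lemma sorbit_refl c : sorbit c c.
Proof.
apply/sorbitP; exists 1%:M; split; first exact: unitmx1.
  by move=> i j; rewrite mxE; case: (i =P j) => [->|//]; rewrite eqxx.
by move=> x y; rewrite !mul1mx.
Qed.

Lemma sorbit_sym c d : sorbit c d -> sorbit d c.
Proof.
move=> [g [ug [eg gc]]]; apply/sorbitP; exists g; split=> // x y.
by rewrite gc !mulmxA mulVmx // !mul1mx.
Qed.

Lemma sorbit_trans c d e : sorbit c d -> sorbit d e -> sorbit c e.
Proof.
move=> /sorbitP[h1 [u1 e1 c1]] /sorbitP[h2 [u2 e2 c2]]; apply/sorbitP.
exists (h1 *m h2); rewrite unitmx_mul u1 u2; split=> //.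
  move: e1 e2 => /even_mx_comm e1 /even_mx_comm e2; apply/even_mx_comm.
  by rewrite mulmxA e1 -!mulmxA e2.
by move=> x y; rewrite -mulmxA c2 c1 !mulmxA.
Qed.

Definition hmx (x0 x1 y0 y1 k : C) : 'M[C]_3 := \matrix_(i, j)
  match nat_of_ord i, nat_of_ord j with
  | 0, 0 => x0 | 0, 1 => x1 | 1, 0 => y0 | 1, 1 => y1 | 2, 2 => k | _, _ => 0%R
  end.

Lemma hmx_even x0 x1 y0 y1 k : even_mx (hmx x0 x1 y0 y1 k).
Proof. by elim/ord3P; elim/ord3P => //; rewrite mxE. Qed.

Lemma hmx_unit (x0 x1 y0 y1 k : C) : x0 * y1 - x1 * y0 != 0 -> k != 0 ->
  hmx x0 x1 y0 y1 k \in unitmx.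
Proof.
move=> d0 k0; pose d := x0 * y1 - x1 * y0.
have /mulmx1_unit[] // : hmx x0 x1 y0 y1 k *m
    hmx (y1 / d) (- x1 / d) (- y0 / d) (x0 / d) k^-1 = 1%:M.
apply/matrixP; elim/ord3P; elim/ord3P; rewrite !mxE sum3 !mxE /= /d; field; by rewrite ?d0 ?k0.
Qed.

Lemma even_unitmxP h : h \in unitmx -> even_mx h -> exists x0 x1 y0 y1 k,
  [/\ h = hmx x0 x1 y0 y1 k, x0 * y1 - x1 * y0 != 0 & k != 0].
Proof.
move=> uh eh; have eg := even_invmx uh eh.
have /matrixP hg := mulmxV uh; set g := invmx h in eg hg.
exists (h o0 o0), (h o0 o1), (h o1 o0), (h o1 o1), (h o2 o2); split.
- by apply/matrixP; elim/ord3P; elim/ord3P; rewrite mxE //= eh.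
- move: (hg o0 o0) (hg o0 o1) (hg o1 o0) (hg o1 o1).
  rewrite !mxE !sum3 (eh o0 o2) // (eh o1 o2) // !mul0r !addr0 /= => e1 e2 e3 e4.
  have : (h o0 o0 * h o1 o1 - h o0 o1 * h o1 o0) *
         (g o0 o0 * g o1 o1 - g o0 o1 * g o1 o0) = 1.
    transitivity ((h o0 o0 * g o0 o0 + h o0 o1 * g o1 o0) *
      (h o1 o0 * g o0 o1 + h o1 o1 * g o1 o1) -
      (h o0 o0 * g o0 o1 + h o0 o1 * g o1 o1) *
      (h o1 o0 * g o0 o0 + h o1 o1 * g o1 o0)); first by ring.
    by rewrite e1 e2 e3 e4 mulr1 mulr0 subr0.
  by move=> e; apply/eqP => e0; move/eqP: e; rewrite e0 mul0r eq_sym oner_eq0.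
- move: (hg o2 o2); rewrite !mxE sum3 (eh o2 o0) // (eh o2 o1) // !mul0r !add0r => e.
  by apply/eqP => e0; move/eqP: e; rewrite e0 mul0r eq_sym oner_eq0.
Qed.

(** * The seven families *)

Definition mk (c000 c001 c010 c011 c100 c101 c110 c111 a0 a1 b0 b1 s0 s1 : C) : sc :=
  fun i j k => match nat_of_ord i, nat_of_ord j, nat_of_ord k with
  | 0, 0, 0 => c000 | 0, 0, 1 => c001 | 0, 1, 0 => c010 | 0, 1, 1 => c011
  | 1, 0, 0 => c100 | 1, 0, 1 => c101 | 1, 1, 0 => c110 | 1, 1, 1 => c111
  | 0, 2, 2 => a0 | 1, 2, 2 => a1 | 2, 0, 2 => b0 | 2, 1, 2 => b1
  | 2, 2, 0 => s0 | 2, 2, 1 => s1 | _, _, _ => 0%R end.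

Lemma mk_even c000 c001 c010 c011 c100 c101 c110 c111 a0 a1 b0 b1 s0 s1 :
  even_sc (mk c000 c001 c010 c011 c100 c101 c110 c111 a0 a1 b0 b1 s0 s1).
Proof. by elim/ord3P; elim/ord3P; elim/ord3P. Qed.

Lemma even_scE c : even_sc c ->
  c = mk (c o0 o0 o0) (c o0 o0 o1) (c o0 o1 o0) (c o0 o1 o1)
         (c o1 o0 o0) (c o1 o0 o1) (c o1 o1 o0) (c o1 o1 o1)
         (c o0 o2 o2) (c o1 o2 o2) (c o2 o0 o2) (c o2 o1 o2) (c o2 o2 o0) (c o2 o2 o1).
Proof.
by move=> ec; apply: sc_ext; elim/ord3P; elim/ord3P; elim/ord3P => //=; apply: ec.
Qed.

(* The commutative even products: for l = (m, n), l' = (m', n') and L = (mu, - la), the forms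
   chi = l'(L) l and chi' = l(L) l' are multiplicative; when they are independent, the even part
   is the product of two copies of C with projections chi and chi'.  The odd part is given by
   a = e chi, b = d chi. *)
Definition comm_sc (la mu m n m' n' e d : C) : sc :=
  let p := m * m' in let r := m * n' + m' * n in let q := - (n * n') in
  let k := mu * m' - la * n' in
  mk (mu * p - la * r) (la * p) (la * q) (mu * p)
     (la * q) (mu * p) (mu * q) (la * q + mu * r)
     (e * (k * m)) (e * (k * n)) (d * (k * m)) (d * (k * n)) 0 0.

(** On the even part xy = q(x) q(y) v; the square of f1 is k (q1, -q0), which spans the kernel of q
    when k and q are nonzero. *)
Definition ff_sc (q0 q1 v0 v1 k : C) : sc :=
  mk (q0 * q0 * v0) (q0 * q0 * v1) (q0 * q1 * v0) (q0 * q1 * v1)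
     (q1 * q0 * v0) (q1 * q0 * v1) (q1 * q1 * v0) (q1 * q1 * v1)
     0 0 0 0 (k * q1) (- (k * q0)).

(** On the even part xy = q(y) x; the odd part is given by x f1 = e q(x) f1 and f1 x = d q(x) f1. *)
Definition right_sc (q0 q1 e d : C) : sc :=
  mk q0 0 q1 0 0 q0 0 q1 (e * q0) (e * q1) (d * q0) (d * q1) 0 0.

Definition comm_can (e d : C) : sc := mk 1 0 0 0 0 0 0 1 e 0 d 0 0 0.
Definition ff_can : sc := mk 1 0 0 0 0 0 0 0 0 0 0 0 0 1.
Definition right_can (e d : C) : sc := mk 1 0 0 0 0 1 0 0 e 0 d 0 0 0.

Lemma R01E : R01 = comm_can 0 0.
Proof. by apply: sc_ext; elim/ord3P; elim/ord3P; elim/ord3P. Qed.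
Lemma R02E : R02 = comm_can 1 1.
Proof. by apply: sc_ext; elim/ord3P; elim/ord3P; elim/ord3P. Qed.
Lemma R04E : R04 = comm_can 0 1.
Proof. by apply: sc_ext; elim/ord3P; elim/ord3P; elim/ord3P. Qed.
Lemma R10E : R10 = ff_can.
Proof. by apply: sc_ext; elim/ord3P; elim/ord3P; elim/ord3P. Qed.
Lemma R25E : R25 = right_can 0 0.
Proof. by apply: sc_ext; elim/ord3P; elim/ord3P; elim/ord3P. Qed.
Lemma R31E : R31 = right_can 0 1.
Proof. by apply: sc_ext; elim/ord3P; elim/ord3P; elim/ord3P. Qed.
Lemma R33E : R33 = right_can 1 1.
Proof. by apply: sc_ext; elim/ord3P; elim/ord3P; elim/ord3P. Qed.

Lemma ff_sc_perm q0 q1 v0 v1 k : permVar (ff_sc q0 q1 v0 v1 k).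
Proof.
apply/permVarP; split; first exact: mk_even.
by elim/ord3P; elim/ord3P; elim/ord3P; elim/ord3P; split; rewrite !sum3 /ff_sc /mk /=; ring.
Qed.

(** Right multiplication on f1 is zero or a character, and by the perm identity left multiplication
    is zero or equal to it. *)
Definition types : seq (C * C) := [:: (0, 0); (0, 1); (1, 1)].

Lemma comm_sc_perm la mu m n m' n' ed : ed \in types ->
  permVar (comm_sc la mu m n m' n' ed.1 ed.2).
Proof.
move=> types_ed; apply/permVarP; split; first exact: mk_even.
by move: types_ed; rewrite !inE => /or3P[] /eqP ->;
  elim/ord3P; elim/ord3P; elim/ord3P; elim/ord3P; split; rewrite !sum3 /comm_sc /mk /=; ring.
Qed.

Lemma right_sc_perm q0 q1 ed : ed \in types -> permVar (right_sc q0 q1 ed.1 ed.2).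
Proof.
move=> types_ed; apply/permVarP; split; first exact: mk_even.
by move: types_ed; rewrite !inE => /or3P[] /eqP ->;
  elim/ord3P; elim/ord3P; elim/ord3P; elim/ord3P; split; rewrite !sum3 /right_sc /mk /=; ring.
Qed.

(** A structure is recovered from its image under an invertible h, so an orbit element is identified
    by a family member with the same h and target. *)
Lemma isom_uniq h c c' d : h \in unitmx -> isom h c d -> isom h c' d -> c = c'.
Proof.
move=> uh hc hc'; apply: sc_ext => i j k.
have e : h *m mulv c (delta_mx i 0) (delta_mx j 0) = h *m mulv c' (delta_mx i 0) (delta_mx j 0).
  by rewrite hc hc'.
have := congr1 (mulmx (invmx h)) e; rewrite !mulmxA mulVmx // !mul1mx !mulv_delta.
by move=> /colP/(_ k); rewrite !mxE.
Qed.

(** The first two rows are chi and chi', the projections of the even part; z is free because f1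
    squares to zero. *)
Lemma comm_sc_isom la mu m n m' n' z e d :
  isom (hmx ((mu * m' - la * n') * m) ((mu * m' - la * n') * n)
            ((mu * m - la * n) * m') ((mu * m - la * n) * n') z)
    (comm_sc la mu m n m' n' e d) (comm_can e d).
Proof.
apply/isomP; elim/ord3P; elim/ord3P; elim/ord3P;
  rewrite /hom_basis !sum3 !mxE /comm_sc /comm_can /mk /=; ring.
Qed.

Lemma sorbit_comm_sc la mu m n m' n' e d :
  (mu * m' - la * n') * (mu * m - la * n) * (m * n' - n * m') != 0 ->
  sorbit (comm_can e d) (comm_sc la mu m n m' n' e d).
Proof.
move=> nz; apply/sorbitP.
exists (hmx ((mu * m' - la * n') * m) ((mu * m' - la * n') * n)
            ((mu * m - la * n) * m') ((mu * m - la * n) * n') 1).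
split; [|exact: hmx_even|exact: comm_sc_isom].
apply: hmx_unit; last exact: oner_neq0.
apply: contra nz => /eqP z; apply/eqP; rewrite -[RHS]z; ring.
Qed.

(* la and mu are chosen so that l(L) = l'(L) = 1, hence chi = l and chi' = l'. *)
Lemma sorbit_comm_can e d c : sorbit (comm_can e d) c ->
  exists la mu m n m' n', c = comm_sc la mu m n m' n' e d /\
    (mu * m' - la * n') * (mu * m - la * n) * (m * n' - n * m') != 0.
Proof.
move=> /sorbitP[h [uh eh hc]]; have [x0 [x1 [y0 [y1 [k [hE d0 k0]]]]]] := even_unitmxP uh eh.
pose det := x0 * y1 - x1 * y0.
pose la := (y0 - x0) / det; pose mu := (y1 - x1) / det.
have l1 : mu * x0 - la * x1 = 1 by rewrite /mu /la /det; field.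
have l2 : mu * y0 - la * y1 = 1 by rewrite /mu /la /det; field.
exists la, mu, x0, x1, y0, y1; split; last by rewrite l1 l2 !mul1r.
apply: (isom_uniq uh hc); rewrite hE.
by have := comm_sc_isom la mu x0 x1 y0 y1 k e d; rewrite l1 l2 !mul1r.
Qed.

(** The first row is q(v) q, which is multiplicative since q(xy) = q(x) q(y) q(v), and it kills the
    square of f1. The second row kills v, and its value on the square of f1 must be the square of
    z. *)
Lemma ff_sc_isom q0 q1 v0 v1 k y0 y1 z :
  y0 * v0 + y1 * v1 = 0 -> k * (y0 * q1 - y1 * q0) = z * z ->
  isom (hmx ((q0 * v0 + q1 * v1) * q0) ((q0 * v0 + q1 * v1) * q1) y0 y1 z) (ff_sc q0 q1 v0 v1 k) ff_can.
Proof.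
move=> yv yk; apply/isomP; elim/ord3P; elim/ord3P; elim/ord3P;
  rewrite /hom_basis !sum3 !mxE /ff_sc /ff_can /mk /=.
all: try by ring.
- transitivity (q0 * q0 * (y0 * v0 + y1 * v1)); first ring. by rewrite yv; ring.
- transitivity (q0 * q1 * (y0 * v0 + y1 * v1)); first ring. by rewrite yv; ring.
- transitivity (q0 * q1 * (y0 * v0 + y1 * v1)); first ring. by rewrite yv; ring.
- transitivity (q1 * q1 * (y0 * v0 + y1 * v1)); first ring. by rewrite yv; ring.
- transitivity (k * (y0 * q1 - y1 * q0)); first ring. by rewrite yk; ring.
Qed.

Lemma sorbit_ff_sc q0 q1 v0 v1 k : (q0 * v0 + q1 * v1) * k != 0 ->
  sorbit ff_can (ff_sc q0 q1 v0 v1 k).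
Proof.
move=> nz; have := nz; rewrite mulf_eq0 negb_or => /andP[x0 k0].
pose x := q0 * v0 + q1 * v1.
(* The second row annihilates v and is normalised to take the value 1 on the square of f1. *)
apply/sorbitP; exists (hmx (x * q0) (x * q1) (v1 / (k * x)) (- v0 / (k * x)) 1).
split; [|exact: hmx_even|].
  apply: hmx_unit; last exact: oner_neq0.
  rewrite (_ : _ - _ = - (x / k)); first by rewrite oppr_eq0 mulf_neq0 // invr_eq0.
  by rewrite /x; field; rewrite k0 x0.
by apply: ff_sc_isom; rewrite /x; field; rewrite k0 x0.
Qed.

Lemma sorbit_ff_can c : sorbit ff_can c ->
  exists q0 q1 v0 v1 k, c = ff_sc q0 q1 v0 v1 k /\
    [/\ q0 * v0 + q1 * v1 != 0, k != 0 & (q0 != 0) || (q1 != 0)].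
Proof.
move=> /sorbitP[h [uh eh hc]]; have [x0 [x1 [y0 [y1 [k [hE d0 k0]]]]]] := even_unitmxP uh eh.
pose det := x0 * y1 - x1 * y0.
have e1 : x0 * (y1 / det) + x1 * (- y0 / det) = 1 by rewrite /det; field.
(* Here q is the first row of h, v is the vector with first coordinate 1 and second coordinate 0
   under h, and the last parameter is solved from the square of f1. *)
exists x0, x1, (y1 / det), (- y0 / det), (- (k * k) / det); split; last first.
  rewrite e1; split; first exact: oner_neq0.
    by rewrite mulf_neq0 ?invr_eq0 // oppr_eq0 mulf_neq0.
  by rewrite -negb_and; apply: contra d0 => /andP[/eqP-> /eqP->]; rewrite !mul0r subrr.
apply: (isom_uniq uh hc); rewrite hE -[x0 in hmx x0]mul1r -[x1 in hmx _ x1]mul1r -e1.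
by apply: ff_sc_isom; rewrite /det; field.
Qed.

Lemma right_sc_isom q0 q1 y0 y1 z e d :
  isom (hmx q0 q1 y0 y1 z) (right_sc q0 q1 e d) (right_can e d).
Proof.
apply/isomP; elim/ord3P; elim/ord3P; elim/ord3P;
  rewrite /hom_basis !sum3 !mxE /right_sc /right_can /mk /=; ring.
Qed.

Lemma sorbit_right_sc q0 q1 e d : (q0 != 0) || (q1 != 0) ->
  sorbit (right_can e d) (right_sc q0 q1 e d).
Proof.
case/orP => q; apply/sorbitP.
  exists (hmx q0 q1 0 1 1); split; [|exact: hmx_even|exact: right_sc_isom].
  by apply: hmx_unit; rewrite ?oner_neq0 // mulr1 mulr0 subr0.
exists (hmx q0 q1 1 0 1); split; [|exact: hmx_even|exact: right_sc_isom].
by apply: hmx_unit; rewrite ?oner_neq0 // mulr1 mulr0 sub0r oppr_eq0.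
Qed.

Lemma sorbit_right_can e d c : sorbit (right_can e d) c ->
  exists q0 q1, c = right_sc q0 q1 e d /\ ((q0 != 0) || (q1 != 0)).
Proof.
move=> /sorbitP[h [uh eh hc]]; have [x0 [x1 [y0 [y1 [k [hE d0 k0]]]]]] := even_unitmxP uh eh.
exists x0, x1; split.
  by apply: (isom_uniq uh hc); rewrite hE; apply: right_sc_isom.
by rewrite -negb_and; apply: contra d0 => /andP[/eqP-> /eqP->]; rewrite !mul0r subrr.
Qed.

(** All constants are trilinear in (la, mu), (m, n), (m', n'), so two of the three scales can be
    absorbed into the third. *)
Lemma comm_sc_scale la mu m n m' n' e d : la != 0 -> m != 0 ->
  comm_sc la mu m n m' n' e d = comm_sc 1 (mu / la) 1 (n / m) (la * m * m') (la * m * n') e d.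
Proof.
move=> la0 m0; apply: sc_ext; elim/ord3P; elim/ord3P; elim/ord3P; rewrite /comm_sc /mk /= ?mul1r //.
all: by field; rewrite ?la0 ?m0.
Qed.

Lemma ff_sc_scale q0 q1 v0 v1 k : q0 != 0 ->
  ff_sc q0 q1 v0 v1 k = ff_sc 1 (q1 / q0) (q0 * q0 * v0) (q0 * q0 * v1) (k * q0).
Proof.
move=> q0n; apply: sc_ext; elim/ord3P; elim/ord3P; elim/ord3P; rewrite /ff_sc /mk /= ?mul1r //.
all: by field; rewrite ?q0n.
Qed.

(** * Polynomials cutting out the complement of each orbit *)

Definition ob (x : bool) : 'I_3 := if x then o1 else o0.
Definition lchar (c : sc) (x : bool) : C := c (ob x) o2 o2.
Definition rchar (c : sc) (x : bool) : C := c o2 (ob x) o2.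
Definition ffcoef (c : sc) (x : bool) : C := c o2 o2 (ob x).
(** The coordinates of the commutator of e1 and e2, swapped and with one sign changed so that on
    [right_sc] they are (q0, q1). *)
Definition comm_defect (c : sc) (x : bool) : C :=
  if x then c o0 o1 o0 - c o1 o0 o0 else c o1 o0 o1 - c o0 o1 o1.
(** The trace of left multiplication on the even part; it is chi + chi' on [comm_sc]. *)
Definition tr (c : sc) (x : bool) : C := c (ob x) o0 o0 + c (ob x) o1 o1.
Definition mul_form (c : sc) (t : bool -> C) (x y : bool) : C :=
  c (ob x) (ob y) o0 * t false + c (ob x) (ob y) o1 * t true.
(** The determinant of the trace form (x, y) -> tr(xy). On [comm_sc] it is the squared determinant
    of chi and chi', and it is zero on the other families. *)
Definition trdisc (c : sc) : C :=
  mul_form c (tr c) false false * mul_form c (tr c) true true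
  - mul_form c (tr c) false true * mul_form c (tr c) true false.

(* If rchar is one of the two characters chi, chi' of a commutative even part, then tr - rchar is
   the other one, hence multiplicative; if rchar = 0, then tr = chi + chi' is not multiplicative
   when trdisc <> 0. *)
Definition sep01 (x y : bool) (c : sc) : C :=
  trdisc c * ((tr c x - rchar c x) * (tr c y - rchar c y)
              - mul_form c (fun z => tr c z - rchar c z) x y).
Definition sep02 (x y : bool) (c : sc) : C := trdisc c * lchar c x.
Definition sep04 (x y : bool) (c : sc) : C :=
  trdisc c * (rchar c x * (lchar c x - rchar c x)).
(** Only the family [ff_sc] has nonzero [ffcoef], and there [tr] is q(v) q. *)
Definition sep10 (x y : bool) (c : sc) : C := ffcoef c y * tr c x.
(** For this and the next two: the defect is nonzero only on [right_sc], where it equals q while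
    [rchar] is d q and [lchar] is e q; the second factor selects (e, d). *)
Definition sep25 (x y : bool) (c : sc) : C :=
  comm_defect c x * (comm_defect c x - rchar c x).
Definition sep31 (x y : bool) (c : sc) : C := comm_defect c x * (rchar c x - lchar c x).
Definition sep33 (x y : bool) (c : sc) : C := comm_defect c x * lchar c x.

Definition sep (i : 'I_7) : bool -> bool -> sc -> C :=
  nth sep01 [:: sep01; sep02; sep04; sep10; sep25; sep31; sep33] i.

Definition psi (i : 'I_7) (p : nat -> C) : sc :=
  let cm := comm_sc (p 0) (p 1) (p 2) (p 3) (p 4) (p 5) in
  let rt := right_sc (p 0) (p 1) in
  nth (cm 0 0) [:: cm 0 0; cm 1 1; cm 0 1; ff_sc (p 0) (p 1) (p 2) (p 3) (p 4);
                   rt 0 0; rt 0 1; rt 1 1] i.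

Lemma ord7P (P : 'I_7 -> Prop) :
  P (@Ordinal 7 0 isT) -> P (@Ordinal 7 1 isT) -> P (@Ordinal 7 2 isT) ->
  P (@Ordinal 7 3 isT) -> P (@Ordinal 7 4 isT) -> P (@Ordinal 7 5 isT) ->
  P (@Ordinal 7 6 isT) -> forall i, P i.
Proof.
move=> P0 P1 P2 P3 P4 P5 P6 [[|[|[|[|[|[|[|//]]]]]]] lti].
- by rewrite (_ : Ordinal lti = @Ordinal 7 0 isT) //; apply: val_inj.
- by rewrite (_ : Ordinal lti = @Ordinal 7 1 isT) //; apply: val_inj.
- by rewrite (_ : Ordinal lti = @Ordinal 7 2 isT) //; apply: val_inj.
- by rewrite (_ : Ordinal lti = @Ordinal 7 3 isT) //; apply: val_inj.
- by rewrite (_ : Ordinal lti = @Ordinal 7 4 isT) //; apply: val_inj.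
- by rewrite (_ : Ordinal lti = @Ordinal 7 5 isT) //; apply: val_inj.
- by rewrite (_ : Ordinal lti = @Ordinal 7 6 isT) //; apply: val_inj.
Qed.

Ltac polyfun_tac := repeat first
  [ exact: pf_const | exact: pf_coord | apply: polyfun_sub | apply: polyfun_opp
  | apply: pf_add | apply: pf_mul ].

Lemma tr_poly x : polyfun (fun c => tr c x).
Proof. rewrite /tr; polyfun_tac. Qed.

Lemma rchar_poly x : polyfun (fun c => rchar c x).
Proof. exact: pf_coord. Qed.

Lemma lchar_poly x : polyfun (fun c => lchar c x).
Proof. exact: pf_coord. Qed.

Lemma comm_defect_poly x : polyfun (fun c => comm_defect c x).
Proof. by case: x; rewrite /comm_defect; polyfun_tac. Qed.

Lemma mul_form_poly (t : sc -> bool -> C) x y : (forall z, polyfun (fun c => t c z)) ->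
  polyfun (fun c => mul_form c (t c) x y).
Proof.
by move=> pt; rewrite /mul_form; apply: pf_add; apply: pf_mul => //; apply: pf_coord.
Qed.

Lemma trdisc_poly : polyfun trdisc.
Proof.
by apply: polyfun_sub; apply: pf_mul; apply: mul_form_poly => z; apply: tr_poly.
Qed.

Lemma sep_poly i x y : polyfun (sep i x y).
Proof.
have := (trdisc_poly, tr_poly, rchar_poly, lchar_poly, comm_defect_poly).
move=> [[[[pD pt] pr] pl] pc].
elim/ord7P: i.
- apply: pf_mul => //; apply: polyfun_sub.
    by apply: pf_mul; apply: polyfun_sub; [exact: pt|exact: pr|exact: pt|exact: pr].
  by apply: mul_form_poly => z; apply: polyfun_sub; [exact: pt|exact: pr].
- by apply: pf_mul.
- by apply: pf_mul => //; apply: pf_mul => //; apply: polyfun_sub; [exact: pl|exact: pr].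
- by apply: pf_mul => //; apply: pf_coord.
- by apply: pf_mul => //; apply: polyfun_sub; [exact: pc|exact: pr].
- by apply: pf_mul => //; apply: polyfun_sub; [exact: pr|exact: pl].
- by apply: pf_mul.
Qed.

Lemma trdisc_comm_sc la mu m n m' n' e d : trdisc (comm_sc la mu m n m' n' e d) =
  ((mu * m' - la * n') * (mu * m - la * n) * (m * n' - n * m')) ^+ 2.
Proof. rewrite /trdisc /mul_form /tr /comm_sc /mk /=; ring. Qed.

Lemma trdisc_ff_sc q0 q1 v0 v1 k : trdisc (ff_sc q0 q1 v0 v1 k) = 0.
Proof. rewrite /trdisc /mul_form /tr /ff_sc /mk /=; ring. Qed.

Lemma trdisc_right_sc q0 q1 e d : trdisc (right_sc q0 q1 e d) = 0.
Proof. rewrite /trdisc /mul_form /tr /right_sc /mk /=; ring. Qed.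

Lemma sep_psi i j x y p : i != j -> sep i x y (psi j p) = 0.
Proof.
elim/ord7P: i; elim/ord7P: j => //= _; rewrite /sep /psi /=;
  rewrite ?/sep01 ?/sep02 ?/sep04 ?/sep10 ?/sep25 ?/sep31 ?/sep33;
  rewrite ?trdisc_ff_sc ?trdisc_right_sc ?mul0r //.
all: case: x; case: y;
  rewrite /ffcoef /mul_form /comm_defect /tr /lchar /rchar /comm_sc /ff_sc /right_sc /mk /=; ring.
Qed.

Lemma sep_sorbit i x y p : sep i x y (psi i p) != 0 -> sorbit (Rk i) (psi i p).
Proof.
have D la mu m n m' n' e d u : trdisc (comm_sc la mu m n m' n' e d) * u != 0 ->
    sorbit (comm_can e d) (comm_sc la mu m n m' n' e d).
  rewrite trdisc_comm_sc mulf_eq0 negb_or sqrf_eq0 => /andP[h _].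
  exact: sorbit_comm_sc.
elim/ord7P: i; rewrite /sep /psi /Rk /= ?R01E ?R02E ?R04E ?R10E ?R25E ?R31E ?R33E.
- exact: D.
- exact: D.
- exact: D.
- move=> h; apply: sorbit_ff_sc; apply: contra h => /eqP z.
  rewrite (_ : sep10 _ _ _ = (if x then p 1%N else p 0%N) *
    (if y then - p 0%N else p 1%N) * ((p 0%N * p 2 + p 1%N * p 3) * p 4)); first by rewrite z mulr0.
  by case: x; case: y; rewrite /sep10 /ffcoef /tr /ff_sc /mk /=; ring.
all: move=> h; apply: sorbit_right_sc; rewrite -negb_and; apply: contra h => /andP[/eqP z0 /eqP z1].
all: rewrite z0 z1; case: x; rewrite ?/sep25 ?/sep31 ?/sep33 /comm_defect /right_sc /mk /=; apply/eqP; ring.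
Qed.

Lemma sorbit_sep i c : sorbit (Rk i) c ->
  exists p, c = psi i p /\ exists x y, sep i x y c != 0.
Proof.
have D e d c' : sorbit (comm_can e d) c' -> exists p : nat -> C,
    c' = comm_sc (p 0) (p 1) (p 2) (p 3) (p 4) (p 5) e d /\ trdisc c' != 0.
  move=> /sorbit_comm_can[la [mu [m [n [m' [n' [-> nz]]]]]]].
  exists (nth 0 [:: la; mu; m; n; m'; n']); split=> //.
  by rewrite trdisc_comm_sc sqrf_eq0.
have R e d c' : sorbit (right_can e d) c' -> exists p : nat -> C,
    c' = right_sc (p 0) (p 1) e d /\ exists x, comm_defect c' x != 0.
  move=> /sorbit_right_can[q0 [q1 [-> /orP nz]]].
  exists (nth 0 [:: q0; q1]); split=> //.
  by case: nz => nz; [exists false|exists true]; rewrite /comm_defect /right_sc /mk /= subr0.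
(* If the determinant of two forms is nonzero, neither form is zero; this is applied to the two
   characters. *)
have two c' (t t' : bool -> C) : trdisc c' != 0 ->
    trdisc c' = (t false * t' true - t true * t' false) ^+ 2 -> exists x, t x != 0.
  move=> nz tE; case: (eqVneq (t false) 0) => [t0|]; last by exists false.
  exists true; apply: contra nz => /eqP t1.
  by rewrite tE t0 t1 !mul0r subrr expr0n.
elim/ord7P: i; rewrite /sep /psi /Rk /= ?R01E ?R02E ?R04E ?R10E ?R25E ?R31E ?R33E.
- move=> /D[p [cE nz]]; exists p; split=> //.
  (* As tr = chi + chi', E(x, y) = chi(x) chi'(y) + chi'(x) chi(y). Its discriminant is again
     [trdisc], so E is not zero. *)
  pose E x y := tr c x * tr c y - mul_form c (tr c) x y.
  have ED : trdisc c = E false true ^+ 2 - E false false * E true true.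
    by rewrite /E cE /trdisc /mul_form /tr /comm_sc /mk /=; ring.
  have sE x y : sep01 x y c = trdisc c * E x y.
    by rewrite /sep01 /E cE; case: x; case: y; rewrite /mul_form /tr /rchar /comm_sc /mk /=; ring.
  case: (eqVneq (E false true) 0) => [e0|e0]; last first.
    by exists false, true; rewrite sE mulf_neq0.
  exists false, false; rewrite sE mulf_neq0 //; apply: contra nz => /eqP e1.
  by rewrite ED e0 e1 mul0r subr0 expr0n.
- move=> /D[p [cE nz]]; exists p; split=> //.
  have [|x lx] := two c (lchar c) (fun x => tr c x - lchar c x) nz.
    by rewrite cE /trdisc /mul_form /tr /lchar /comm_sc /mk /=; ring.
  by exists x, false; rewrite /sep02 mulf_neq0.
- move=> /D[p [cE nz]]; exists p; split=> //.
  have [|x rx] := two c (rchar c) (fun x => tr c x - rchar c x) nz.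
    by rewrite cE /trdisc /mul_form /tr /rchar /comm_sc /mk /=; ring.
  exists x, false; rewrite /sep04 !mulf_neq0 //.
  have -> : lchar c x = 0 by rewrite cE; case: (x); rewrite /lchar /comm_sc /mk /= mul0r.
  by rewrite sub0r oppr_eq0.
- move=> /sorbit_ff_can[q0 [q1 [v0 [v1 [k [-> [v k0 /orP q]]]]]]].
  exists (nth 0 [:: q0; q1; v0; v1; k]); split=> //.
  have trE x : tr (ff_sc q0 q1 v0 v1 k) x = (if x then q1 else q0) * (q0 * v0 + q1 * v1).
    by case: x; rewrite /tr /ff_sc /mk /=; ring.
  by case: q => q; [exists false, true|exists true, false];
    rewrite /sep10 trE /ffcoef /ff_sc /mk /= !mulf_neq0 ?oppr_eq0 ?mulf_neq0.
- move=> /R[p [cE [x nx]]]; exists p; split=> //; exists x, false.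
  rewrite /sep25 mulf_neq0 // (_ : rchar c x = 0) ?subr0 //.
  by rewrite cE; case: (x); rewrite /rchar /right_sc /mk /= mul0r.
- move=> /R[p [cE [x nx]]]; exists p; split=> //; exists x, false.
  rewrite /sep31 mulf_neq0 // (_ : _ - _ = comm_defect c x) //.
  by rewrite cE; case: (x); rewrite /comm_defect /lchar /rchar /right_sc /mk /=; ring.
- move=> /R[p [cE [x nx]]]; exists p; split=> //; exists x, false.
  rewrite /sep33 mulf_neq0 // (_ : lchar c x = comm_defect c x) //.
  by rewrite cE; case: (x); rewrite /comm_defect /lchar /right_sc /mk /=; ring.
Qed.

Lemma psi_perm i p : permVar (psi i p).
Proof.
elim/ord7P: i; rewrite /psi /=.
- by apply: (@comm_sc_perm _ _ _ _ _ _ (0, 0)); rewrite inE eqxx.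
- by apply: (@comm_sc_perm _ _ _ _ _ _ (1, 1)); rewrite !inE eqxx !orbT.
- by apply: (@comm_sc_perm _ _ _ _ _ _ (0, 1)); rewrite !inE eqxx orbT.
- exact: ff_sc_perm.
- by apply: (@right_sc_perm _ _ (0, 0)); rewrite inE eqxx.
- by apply: (@right_sc_perm _ _ (0, 1)); rewrite !inE eqxx orbT.
- by apply: (@right_sc_perm _ _ (1, 1)); rewrite !inE eqxx !orbT.
Qed.

Ltac polyon_tac := repeat first
  [ exact: po_const | exact: po_coord | apply: po_opp
  | apply: po_add | apply: po_mul ].

Lemma psi_family i : family (psi i).
Proof.
elim/ord7P: i; rewrite /psi /=; elim/ord3P; elim/ord3P; elim/ord3P;
  rewrite /comm_sc /ff_sc /right_sc /mk /=; polyon_tac.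
Qed.

(* Four of the parameters are enough generically. *)
Definition phi (i : 'I_7) (p : 'I_4 -> C) : sc :=
  let x := p (inord 0) in let y := p (inord 1) in
  let z := p (inord 2) in let w := p (inord 3) in
  psi i (nth 0 (nth [:: 1; x; 1; y; z; w]
    [:: [:: 1; x; 1; y; z; w]; [:: 1; x; 1; y; z; w]; [:: 1; x; 1; y; z; w];
        [:: 1; x; y; z; w]; [:: x; y]; [:: x; y]; [:: x; y]] i)).

Lemma phi_family i : family (phi i).
Proof.
elim/ord7P: i; rewrite /phi /psi /=; elim/ord3P; elim/ord3P; elim/ord3P;
  rewrite /comm_sc /ff_sc /right_sc /mk /=; polyon_tac.
Qed.

(** Where the parameters to be normalised are nonzero, scaling brings [psi] into the image of [phi];
    [polyon_domain] then removes this condition. *)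
Lemma phi_dense i g : polyfun g -> (forall p, g (phi i p) = 0) -> vanishes (img (psi i)) g.
Proof.
move=> pg g0 _ [p ->]; move: p.
have pgp := polyfun_family (psi_family i) pg.
have tuple4 (x y z w : C) : exists p : 'I_4 -> C,
    [/\ p (inord 0) = x, p (inord 1) = y, p (inord 2) = z & p (inord 3) = w].
  by exists (fun i => nth 0 [:: x; y; z; w] i); rewrite !inordK.
have generic (u : (nat -> C) -> C) : polyon u -> u (fun=> 1) != 0 ->
    (forall p, u p != 0 -> g (psi i p) = 0) -> forall p, g (psi i p) = 0.
  move=> pu u1 ug; case: (polyon_domain pu pgp) => // [p|u0].
    by case: (eqVneq (u p) 0) => [->|/ug ->]; rewrite ?mul0r ?mulr0.
  by rewrite u0 eqxx in u1.
have comm e d : (forall x y z w, g (comm_sc 1 x 1 y z w e d) = 0) -> forall p : nat -> C,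
    p 0%N * p 2%N != 0 -> g (comm_sc (p 0) (p 1) (p 2) (p 3) (p 4) (p 5) e d) = 0.
  move=> h p; rewrite mulf_eq0 negb_or => /andP[p0 p2].
  by rewrite comm_sc_scale.
elim/ord7P: i g0 pgp generic => g0 _ generic.
1-3: apply: (generic (fun p => p 0%N * p 2%N));
  [by apply: po_mul; apply: po_coord|by rewrite mul1r oner_neq0|].
1-3: apply: comm => x y z w; have [p [<- <- <- <-]] := tuple4 x y z w; exact: g0.
- apply: (generic (fun p => p 0%N)); [exact: po_coord|exact: oner_neq0|].
  move=> p p0; rewrite /psi /= ff_sc_scale //.
  have [q [<- <- <- <-]] := tuple4 (p 1%N / p 0%N) (p 0%N * p 0%N * p 2%N)
    (p 0%N * p 0%N * p 3%N) (p 4%N * p 0%N).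
  exact: g0.
all: move=> p; rewrite /psi /=; have [q [<- <- _ _]] := tuple4 (p 0%N) (p 1%N) 0 0; exact: g0.
Qed.

(** * Every perm structure lies in one of the families *)

(** The hypotheses are the 2 x 2 minors. A nonzero entry of the first row serves as pivot with la =
    1; if that row is zero, la = 0 and mu = 1. *)
Lemma rank_one (u0 u1 u2 w0 w1 w2 : C) :
  u0 * w1 = u1 * w0 -> u0 * w2 = u2 * w0 -> u1 * w2 = u2 * w1 ->
  exists la mu p q r, [/\ u0 = la * p, u1 = la * q & u2 = la * r] /\
                      [/\ w0 = mu * p, w1 = mu * q & w2 = mu * r].
Proof.
move=> h01 h02 h12.
have div (u w u' w' : C) : u != 0 -> u * w' = u' * w -> w' = (w / u) * u'.
  by move=> un h; apply: (mulfI un); rewrite h; field.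
case: (eqVneq u0 0) => [z0|n0]; last first.
  exists 1, (w0 / u0), u0, u1, u2; rewrite !mul1r; split; split=> //.
  - by rewrite divfK.
  - exact: div.
  - exact: div.
case: (eqVneq u1 0) => [z1|n1]; last first.
  exists 1, (w1 / u1), u0, u1, u2; rewrite !mul1r; split; split=> //.
  - by apply: div.
  - by rewrite divfK.
  - exact: div.
case: (eqVneq u2 0) => [z2|n2]; last first.
  exists 1, (w2 / u2), u0, u1, u2; rewrite !mul1r; split; split=> //.
  - by apply: div.
  - by apply: div.
  - by rewrite divfK.
by exists 0, 1, w0, w1, w2; rewrite z0 z1 z2 !mul0r !mul1r.
Qed.

(** This factors p X^2 + r X Y - q Y^2 as (m X + n Y)(m' X + n' Y) by the quadratic formula; Y
    divides it when p = 0. *)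
Lemma binary_quadratic_split (p q r : C) : exists m n m' n',
  [/\ p = m * m', r = m * n' + m' * n & q = - (n * n')].
Proof.
case: (eqVneq p 0) => [->|p0].
  by exists 0, 1, r, (- q); rewrite !mul0r mulr1 add0r mul1r opprK.
pose s := sqrtC (r ^+ 2 + 4 * p * q).
have sE : s * s = r ^+ 2 + 4 * p * q by rewrite -expr2 sqrtCK.
exists p, ((r + s) / 2), 1, ((r - s) / (2 * p)); split; first by rewrite mulr1.
  by field; rewrite p0.
have -> : - ((r + s) / 2 * ((r - s) / (2 * p))) = (s * s - r ^+ 2) / (4 * p).
  by field; rewrite p0.
by rewrite sE; field; rewrite p0.
Qed.

(** The relation [m * b1 = n * b0] turns multiplicativity of b into b_i b_j = b_i chi_j with chi = k
    (m, n), and a nonzero b_i cancels. *)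
Lemma multiplicative_form_half (la mu m n m' n' b0 b1 : C)
    (p := m * m') (r := m * n' + m' * n) (q := - (n * n')) (k := mu * m' - la * n') :
  b0 * b0 = (mu * p - la * r) * b0 + la * p * b1 ->
  b0 * b1 = la * q * b0 + mu * p * b1 ->
  b1 * b1 = mu * q * b0 + (la * q + mu * r) * b1 ->
  (b0 != 0) || (b1 != 0) -> m * b1 = n * b0 -> b0 = k * m /\ b1 = k * n.
Proof.
move=> e00 e01 e11 nz h.
have f00 : b0 * b0 = b0 * (k * m).
  rewrite e00 (_ : _ + _ = (mu * p - la * r) * b0 + la * m' * (m * b1)); last by rewrite /p; ring.
  by rewrite h /p /q /r /k; ring.
have f01 : b0 * b1 = b0 * (k * n).
  rewrite e01 (_ : _ + _ = la * q * b0 + mu * m' * (m * b1)); last by rewrite /p; ring.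
  by rewrite h /p /q /r /k; ring.
have f10 : b1 * b0 = b1 * (k * m).
  rewrite mulrC e01 (_ : _ + _ = - la * n' * (n * b0) + mu * p * b1); last by rewrite /q; ring.
  by rewrite -h /p /q /r /k; ring.
have f11 : b1 * b1 = b1 * (k * n).
  rewrite e11 (_ : _ + _ = - mu * n' * (n * b0) + (la * q + mu * r) * b1); last by rewrite /q; ring.
  by rewrite -h /p /q /r /k; ring.
by case/orP: nz => nz; split; apply: (mulfI nz).
Qed.

Lemma multiplicative_form (la mu m n m' n' b0 b1 : C)
    (p := m * m') (r := m * n' + m' * n) (q := - (n * n')) :
  b0 * b0 = (mu * p - la * r) * b0 + la * p * b1 ->
  b0 * b1 = la * q * b0 + mu * p * b1 ->
  b1 * b1 = mu * q * b0 + (la * q + mu * r) * b1 ->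
  (b0 != 0) || (b1 != 0) ->
  (b0 = (mu * m' - la * n') * m /\ b1 = (mu * m' - la * n') * n) \/
  (b0 = (mu * m - la * n) * m' /\ b1 = (mu * m - la * n) * n').
Proof.
move=> e00 e01 e11 nz.
(* Eliminating between the equations gives la Q = mu Q = 0. If Q were nonzero, the product would be
   zero and multiplicativity would force b = 0. *)
pose Q := (m * b1 - n * b0) * (m' * b1 - n' * b0).
have laQ : la * Q = 0.
  rewrite (_ : la * Q = b1 * ((mu * p - la * r) * b0 + la * p * b1)
                       - b0 * (la * q * b0 + mu * p * b1)); last by rewrite /Q /p /q /r; ring.
  by rewrite -e00 -e01; ring.
have muQ : mu * Q = 0.
  rewrite (_ : mu * Q = b1 * (la * q * b0 + mu * p * b1)
      - b0 * (mu * q * b0 + (la * q + mu * r) * b1)); last by rewrite /Q /p /q /r; ring.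
  by rewrite -e01 -e11; ring.
have Q0 : Q = 0.
  apply/eqP; apply: contraT => Qn.
  move/eqP: laQ; rewrite mulf_eq0 (negbTE Qn) orbF => /eqP la0.
  move/eqP: muQ; rewrite mulf_eq0 (negbTE Qn) orbF => /eqP mu0.
  move: e00 e11 nz; rewrite la0 mu0 !mul0r !addr0 subr0 !mul0r addr0.
  by move=> /eqP; rewrite mulf_eq0 orbb => -> /eqP; rewrite mulf_eq0 orbb => ->.
move/eqP: Q0; rewrite mulf_eq0 !subr_eq0 => /orP[]/eqP h; [left|right].
  exact: (@multiplicative_form_half la mu m n m' n').
apply: (@multiplicative_form_half la mu m' n' m n) => //.
- by rewrite e00 /p /q /r; ring.
- by rewrite e01 /p /q /r; ring.
- by rewrite e11 /p /q /r; ring.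
Qed.

Section PermEquations.
Variables (c : sc) (pc : permVar c).
Let e (x y z : bool) : C := c (ob x) (ob y) (ob z).

Lemma perm_assoc x y z k :
  e x y false * e false z k + e x y true * e true z k =
  e y z false * e x false k + e y z true * e x true k.
Proof.
have [ec bc] := proj1 (permVarP c) pc; have [+ _] := bc (ob x) (ob y) (ob z) (ob k).
rewrite !sum3 (ec (ob x) (ob y) o2) ?(ec (ob y) (ob z) o2) ?mul0r ?addr0 //; by case: x; case: y; case: z.
Qed.

Lemma perm_comm x y z k :
  e y z false * e x false k + e y z true * e x true k =
  e z y false * e x false k + e z y true * e x true k.
Proof.
have [ec bc] := proj1 (permVarP c) pc; have [_ +] := bc (ob x) (ob y) (ob z) (ob k).
rewrite !sum3 (ec (ob y) (ob z) o2) ?(ec (ob z) (ob y) o2); [|by case: y; case: z..].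
by case: y; rewrite mul1r !mul0r !addr0.
Qed.

Lemma perm_lchar x y : lchar c y * lchar c x = rchar c y * lchar c x.
Proof.
have [ec bc] := proj1 (permVarP c) pc; have [_ +] := bc (ob x) (ob y) o2 o2.
rewrite !sum3 (ec (ob y) o2 o0) ?(ec (ob y) o2 o1) ?(ec o2 (ob y) o0) ?(ec o2 (ob y) o1);
  [|by case: y..].
by case: y; rewrite mul1r !mul0r !add0r.
Qed.

Lemma perm_rchar x y : rchar c x * rchar c y = mul_form c (rchar c) x y.
Proof.
have [ec bc] := proj1 (permVarP c) pc; have [+ _] := bc o2 (ob x) (ob y) o2.
rewrite !sum3 (ec o2 (ob x) o0) ?(ec o2 (ob x) o1) ?(ec (ob x) (ob y) o2);
  [|by case: x; case: y..].
by rewrite !mul0r !add0r addr0.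
Qed.

(** The sign rule with y = z = f1 makes x (f1 f1) its own negative. The next three lemmas continue:
    (x f1) f1 = x (f1 f1), f1 (f1 x) = f1 (x f1) and (f1 f1) x = f1 (f1 x) all vanish. *)
Lemma perm_ff_r x k : ffcoef c false * e x false k + ffcoef c true * e x true k = 0.
Proof.
have [ec bc] := proj1 (permVarP c) pc; have [_ +] := bc (ob x) o2 o2 (ob k).
rewrite !sum3 (ec o2 o2 o2) // mul0r addr0 /= expr1 mulN1r => h.
by apply: double_eq0; rewrite [X in X + _]h addNr.
Qed.

Lemma perm_lchar_ff x k : lchar c x * ffcoef c k = 0.
Proof.
rewrite -(perm_ff_r x k).
have [ec bc] := proj1 (permVarP c) pc; have [+ _] := bc (ob x) o2 o2 (ob k).
rewrite !sum3 (ec o2 o2 o2) ?(ec (ob x) o2 o0) ?(ec (ob x) o2 o1); [|by case: x..].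
by rewrite !mul0r !add0r addr0.
Qed.

Lemma perm_rchar_ff x k : rchar c x * ffcoef c k = 0.
Proof.
rewrite -(perm_lchar_ff x k).
have [ec bc] := proj1 (permVarP c) pc; have [_ +] := bc o2 (ob x) o2 (ob k).
rewrite !sum3 (ec (ob x) o2 o0) ?(ec (ob x) o2 o1) ?(ec o2 (ob x) o0) ?(ec o2 (ob x) o1);
  [|by case: x..].
by case: x; rewrite !mul0r !add0r mul1r.
Qed.

Lemma perm_ff_l x k : ffcoef c false * e false x k + ffcoef c true * e true x k = 0.
Proof.
rewrite -(perm_rchar_ff x k).
have [ec bc] := proj1 (permVarP c) pc; have [+ _] := bc o2 o2 (ob x) (ob k).
rewrite !sum3 (ec o2 o2 o2) ?(ec o2 (ob x) o0) ?(ec o2 (ob x) o1); [|by case: x..].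
by rewrite !mul0r !add0r addr0.
Qed.

Lemma perm_lchar_cases : (forall x, lchar c x = 0) \/ (forall x, lchar c x = rchar c x).
Proof.
case: (pselect (forall x, lchar c x = 0)) => [|/existsNP[x /eqP lx]]; first by left.
by right=> y; apply: (mulIf lx); apply: perm_lchar.
Qed.

(** The square s of f1 is nonzero and annihilates the even part on both sides, so the even product
    factors through the form q = (s1, -s0) killing s; the odd actions vanish. *)
Lemma cover_ff x : ffcoef c x != 0 -> exists q0 q1 v0 v1 k, c = ff_sc q0 q1 v0 v1 k.
Proof.
move=> sx.
have l0 y : lchar c y = 0 by apply: (mulIf sx); rewrite perm_lchar_ff mul0r.
have r0 y : rchar c y = 0 by apply: (mulIf sx); rewrite perm_rchar_ff mul0r.
have l0f := l0 false; have l0t := l0 true; have r0f := r0 false; have r0t := r0 true.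
have ec := (proj1 pc).
pose s0 := ffcoef c false; pose s1 := ffcoef c true.
have cE := even_scE ec.
rewrite /lchar /rchar /= in l0f l0t r0f r0t.
rewrite l0f l0t r0f r0t -[c o2 o2 o0]/s0 -[c o2 o2 o1]/s1 in cE.
have div (u v s t : C) : s != 0 -> t * v + s * u = 0 -> u = - (t / s) * v.
  move=> sn h; apply: (mulfI sn); rewrite -[LHS]add0r -(subrr (t * v)) addrAC h.
  by field.
case: x sx => sx.
  have d100 : c o1 o0 o0 = _ := div _ _ _ _ sx (perm_ff_l false false).
  have d101 : c o1 o0 o1 = _ := div _ _ _ _ sx (perm_ff_l false true).
  have d010 : c o0 o1 o0 = _ := div _ _ _ _ sx (perm_ff_r false false).
  have d011 : c o0 o1 o1 = _ := div _ _ _ _ sx (perm_ff_r false true).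
  have d110 : c o1 o1 o0 = _ := div _ _ _ _ sx (perm_ff_l true false).
  have d111 : c o1 o1 o1 = _ := div _ _ _ _ sx (perm_ff_l true true).
  rewrite /e /= d010 -/s0 -/s1 in d110; rewrite /e /= d011 -/s0 -/s1 in d111.
  exists s1, (- s0), (c o0 o0 o0 / (s1 * s1)), (c o0 o0 o1 / (s1 * s1)), (-1).
  rewrite cE d100 d101 d010 d011 d110 d111 /e /= -/s0 -/s1.
  by apply: sc_ext; elim/ord3P; elim/ord3P; elim/ord3P; rewrite /ff_sc /mk //=; field.
have div' (u v s t : C) : s != 0 -> s * u + t * v = 0 -> u = - (t / s) * v.
  by move=> sn h; apply: div => //; rewrite addrC.
have d100 : c o1 o0 o0 = _ := div' _ _ _ _ sx (perm_ff_r true false).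
have d101 : c o1 o0 o1 = _ := div' _ _ _ _ sx (perm_ff_r true true).
have d010 : c o0 o1 o0 = _ := div' _ _ _ _ sx (perm_ff_l true false).
have d011 : c o0 o1 o1 = _ := div' _ _ _ _ sx (perm_ff_l true true).
have d000 : c o0 o0 o0 = _ := div' _ _ _ _ sx (perm_ff_l false false).
have d001 : c o0 o0 o1 = _ := div' _ _ _ _ sx (perm_ff_l false true).
rewrite /e /= d100 -/s0 -/s1 in d000; rewrite /e /= d101 -/s0 -/s1 in d001.
exists s1, (- s0), (c o1 o1 o0 / (s0 * s0)), (c o1 o1 o1 / (s0 * s0)), (-1).
rewrite cE d100 d101 d010 d011 d000 d001 /e /= -/s0 -/s1.
by apply: sc_ext; elim/ord3P; elim/ord3P; elim/ord3P; rewrite /ff_sc /mk //=; field.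
Qed.

Lemma right_mul x : comm_defect c x != 0 -> exists q0 q1,
  (c o0 o0 o0, c o0 o0 o1, c o0 o1 o0, c o0 o1 o1) = (q0, 0, q1, 0) /\
  (c o1 o0 o0, c o1 o0 o1, c o1 o1 o0, c o1 o1 o1) = (0, q0, 0, q1).
Proof.
move=> nx.
have [n0 n0D] : exists u, u = comm_defect c false by eexists.
have [n1 n1D] : exists u, u = comm_defect c true by eexists.
have n0E : n0 = c o1 o0 o1 - c o0 o1 o1 by rewrite n0D.
have n1E : n1 = c o0 o1 o0 - c o1 o0 o0 by rewrite n1D.
have P y k : n1 * e y false k = n0 * e y true k.
  have := perm_comm y false true k; rewrite /e /= => h.
  apply/eqP; rewrite -subr_eq0 n0E n1E; apply/eqP.
  rewrite -(subrr (c o0 o1 o0 * c (ob y) o0 (ob k) + c o0 o1 o1 * c (ob y) o1 (ob k))) {2}h; ring.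
have A1 := perm_assoc false false false true; have A2 := perm_assoc true true true false.
have A3 := perm_assoc true false false true; have A4 := perm_assoc false true true false.
rewrite /e /= in A1 A2 A3 A4.
have cancel (u v w : C) : u != 0 -> u * v = u * w -> v = w by move=> u0 /(mulfI u0).
exists n0, n1; case: x nx; rewrite -?n0D -?n1D => nx.
- have c110 : c o1 o1 o0 = 0.
    apply: (cancel _ _ _ nx); rewrite mulr0 n1E.
    by rewrite -(subrr (c o1 o1 o0 * c o0 o1 o0 + c o1 o1 o1 * c o1 o1 o0)) {2}A2; ring.
  have c100 : c o1 o0 o0 = 0.
    by apply: (cancel _ _ _ nx); rewrite mulr0 (P true false) /e /= c110 mulr0.
  have c010 : c o0 o1 o0 = n1 by rewrite n1E c100 subr0.
  have c111 : c o1 o1 o1 = n1.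
    apply/esym/(cancel _ _ _ nx).
    by move: A4; rewrite c110 c010 mulr0 mul0r addr0 add0r [RHS]mulrC.
  have c101 : c o1 o0 o1 = n0.
    by apply: (cancel _ _ _ nx); rewrite (P true true) /e /= c111 mulrC.
  have c011 : c o0 o1 o1 = 0.
    by rewrite -[LHS](subKr (c o1 o0 o1)) -n0E c101 subrr.
  have c001 : c o0 o0 o1 = 0.
    by apply: (cancel _ _ _ nx); rewrite mulr0 (P false true) /e /= c011 mulr0.
  have c000 : c o0 o0 o0 = n0.
    by apply: (cancel _ _ _ nx); rewrite (P false false) /e /= c010 mulrC.
  by rewrite c000 c001 c010 c011 c100 c101 c110 c111.
- have c001 : c o0 o0 o1 = 0.
    apply: (cancel _ _ _ nx); rewrite mulr0 n0E.
    by rewrite -(subrr (c o0 o0 o0 * c o0 o0 o1 + c o0 o0 o1 * c o1 o0 o1)) {2}A1; ring.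
  have c011 : c o0 o1 o1 = 0.
    by apply: (cancel _ _ _ nx); rewrite mulr0 -(P false true) /e /= c001 mulr0.
  have c101 : c o1 o0 o1 = n0 by rewrite n0E c011 subr0.
  have c000 : c o0 o0 o0 = n0.
    apply/esym/(cancel _ _ _ nx).
    by move: A3; rewrite c001 c101 mulr0 mul0r addr0 add0r [RHS]mulrC.
  have c010 : c o0 o1 o0 = n1.
    by apply: (cancel _ _ _ nx); rewrite -(P false false) /e /= c000 mulrC.
  have c111 : c o1 o1 o1 = n1.
    by apply: (cancel _ _ _ nx); rewrite -(P true true) /e /= c101 mulrC.
  have c100 : c o1 o0 o0 = 0 by rewrite -[LHS](subKr (c o0 o1 o0)) -n1E c010 subrr.
  have c110 : c o1 o1 o0 = 0.
    by apply: (cancel _ _ _ nx); rewrite mulr0 -(P true false) /e /= c100 mulr0.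
  by rewrite c000 c001 c010 c011 c100 c101 c110 c111.
Qed.

Lemma cover_right x : (forall y, ffcoef c y = 0) -> comm_defect c x != 0 ->
  exists q0 q1 e d, (e, d) \in types /\ c = right_sc q0 q1 e d.
Proof.
move=> s0 /right_mul[q0 [q1 [[c000 c001 c010 c011] [c100 c101 c110 c111]]]].
(* Multiplicativity of [rchar] together with xy = q(y) x leaves only [rchar] = 0 or [rchar] = q. *)
have bq y z : rchar c y * (rchar c z - (if z then q1 else q0)) = 0.
  rewrite mulrBr perm_rchar /mul_form.
  by case: y; case: z; rewrite /= ?c000 ?c001 ?c010 ?c011 ?c100 ?c101 ?c110 ?c111; ring.
have cE := even_scE (proj1 pc).
rewrite -[c o2 o2 o0]/(ffcoef c false) -[c o2 o2 o1]/(ffcoef c true) !s0 in cE.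
rewrite -[c o0 o2 o2]/(lchar c false) -[c o1 o2 o2]/(lchar c true) in cE.
rewrite -[c o2 o0 o2]/(rchar c false) -[c o2 o1 o2]/(rchar c true) in cE.
rewrite c000 c001 c010 c011 c100 c101 c110 c111 in cE.
case: (pselect (forall y, rchar c y = 0)) => [r0|/existsNP[y /eqP ry]].
  have l0 y : lchar c y = 0 by case: perm_lchar_cases => ->.
  exists q0, q1, 0, 0; split; first by rewrite inE eqxx.
  by rewrite cE !l0 !r0 /right_sc !mul0r.
have rq z : rchar c z = if z then q1 else q0.
  by move: (bq y z) => /eqP; rewrite mulf_eq0 (negbTE ry) subr_eq0 => /eqP.
case: perm_lchar_cases => le; [exists q0, q1, 0, 1|exists q0, q1, 1, 1]; split.
- by rewrite !inE eqxx orbT.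
- by rewrite cE !le !rq /right_sc !mul0r !mul1r.
- by rewrite !inE eqxx !orbT.
- by rewrite cE !le !rq /right_sc !mul1r.
Qed.

Lemma cover_comm : (forall y, ffcoef c y = 0) -> (forall y, comm_defect c y = 0) ->
  exists la mu m n m' n' e d, (e, d) \in types /\ c = comm_sc la mu m n m' n' e d.
Proof.
move=> s0 n0.
have c100 : c o1 o0 o0 = c o0 o1 o0.
  by apply/eqP; rewrite eq_sym -subr_eq0; apply/eqP; exact: (n0 true).
have c101 : c o1 o0 o1 = c o0 o1 o1.
  by apply/eqP; rewrite -subr_eq0; apply/eqP; exact: (n0 false).
have A1 := perm_assoc false false true false; have A2 := perm_assoc false false true true.
have A3 := perm_assoc false true true false.
rewrite /e /= ?c100 ?c101 in A1 A2 A3.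
(* With a commutative even part these associativity equations are the 2 x 2 minors of the matrix
   with the two rows given here. *)
have [||| la [mu [p [q [r [[c001 c010 u2] [c011 c110 w2]]]]]]] :=
  @rank_one (c o0 o0 o1) (c o0 o1 o0) (c o0 o1 o1 - c o0 o0 o0)
            (c o0 o1 o1) (c o1 o1 o0) (c o1 o1 o1 - c o0 o1 o0).
- apply: (addrI (c o0 o0 o0 * c o0 o1 o0)); rewrite A1; ring.
- apply: (addrI (c o0 o0 o0 * c o0 o1 o1 + c o0 o1 o0 * c o0 o0 o1)).
  transitivity (c o0 o0 o0 * c o0 o1 o1 + c o0 o0 o1 * c o1 o1 o1); first by ring.
  by rewrite A2; ring.
- apply: (addrI (c o0 o1 o0 * c o0 o1 o0 + c o0 o1 o1 * c o1 o1 o0)).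
  by rewrite [in RHS]A3; ring.
have [m [n [m' [n' [pE rE qE]]]]] := binary_quadratic_split p q r.
have c000 : c o0 o0 o0 = mu * p - la * r by rewrite -u2 -c011 subKr.
have c111 : c o1 o1 o1 = la * q + mu * r by rewrite -w2 -c010 addrC subrK.
rewrite c010 in c100; rewrite c011 in c101.
have cE := even_scE (proj1 pc).
rewrite -[c o2 o2 o0]/(ffcoef c false) -[c o2 o2 o1]/(ffcoef c true) !s0 in cE.
rewrite -[c o0 o2 o2]/(lchar c false) -[c o1 o2 o2]/(lchar c true) in cE.
rewrite -[c o2 o0 o2]/(rchar c false) -[c o2 o1 o2]/(rchar c true) in cE.
rewrite c000 c001 c010 c011 c100 c101 c110 c111 in cE.
case: (pselect (forall y, rchar c y = 0)) => [r0|/existsNP[y /eqP ry]].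
  have l0 y : lchar c y = 0 by case: perm_lchar_cases => ->.
  exists la, mu, m, n, m', n', 0, 0; split; first by rewrite inE eqxx.
  by rewrite cE !l0 !r0 /comm_sc !mul0r -pE -qE -rE.
have nz : (rchar c false != 0) || (rchar c true != 0).
  by case: (y) ry => ->; rewrite ?orbT.
have B00 := perm_rchar false false; have B01 := perm_rchar false true.
have B11 := perm_rchar true true.
rewrite /mul_form /= c000 c001 in B00; rewrite /mul_form /= c010 c011 in B01.
rewrite /mul_form /= c110 c111 in B11.
rewrite pE rE qE in B00 B01 B11.
(* Exchanging the linear factors preserves p, q, r, so either character may play the part of chi. *)
have fin m1 n1 m1' n1' : p = m1 * m1' -> r = m1 * n1' + m1' * n1 -> q = - (n1 * n1') ->
    rchar c false = (mu * m1' - la * n1') * m1 /\ rchar c true = (mu * m1' - la * n1') * n1 ->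
    exists la mu m n m' n' e d, (e, d) \in types /\ c = comm_sc la mu m n m' n' e d.
  move=> pE1 rE1 qE1 [b0 b1].
  case: perm_lchar_cases => le.
    exists la, mu, m1, n1, m1', n1', 0, 1; split; first by rewrite !inE eqxx orbT.
    by rewrite cE !le b0 b1 /comm_sc !mul0r !mul1r -pE1 -qE1 -rE1.
  exists la, mu, m1, n1, m1', n1', 1, 1; split; first by rewrite !inE eqxx !orbT.
  by rewrite cE !le b0 b1 /comm_sc !mul1r -pE1 -qE1 -rE1.
have [h|h] := multiplicative_form B00 B01 B11 nz.
  exact: (fin m n m' n').
by apply: (fin m' n' m n) => //; [rewrite mulrC|rewrite addrC|rewrite mulrC].
Qed.

End PermEquations.

Lemma perm_cover c : permVar c -> exists i, img (psi i) c.
Proof.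
move=> pc.
case: (pselect (forall y, ffcoef c y = 0)) => [s0|/existsNP[y /eqP sy]]; last first.
  have [q0 [q1 [v0 [v1 [k ->]]]]] := cover_ff pc sy.
  by exists (@Ordinal 7 3 isT), (nth 0 [:: q0; q1; v0; v1; k]).
case: (pselect (forall y, comm_defect c y = 0)) => [n0|/existsNP[y /eqP ny]]; last first.
  have [q0 [q1 [e [d [+ ->]]]]] := cover_right pc s0 ny.
  rewrite !inE => /or3P[] /eqP[-> ->].
  - by exists (@Ordinal 7 4 isT), (nth 0 [:: q0; q1]).
  - by exists (@Ordinal 7 5 isT), (nth 0 [:: q0; q1]).
  - by exists (@Ordinal 7 6 isT), (nth 0 [:: q0; q1]).
have [la [mu [m [n [m' [n' [e [d [+ ->]]]]]]]]] := cover_comm pc s0 n0.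
rewrite !inE => /or3P[] /eqP[-> ->].
- by exists (@Ordinal 7 0 isT), (nth 0 [:: la; mu; m; n; m'; n']).
(* The order of [types] differs from that of the families: (0, 1) belongs to [R04] and (1, 1) to
   [R02]. *)
- by exists (@Ordinal 7 2 isT), (nth 0 [:: la; mu; m; n; m'; n']).
- by exists (@Ordinal 7 1 isT), (nth 0 [:: la; mu; m; n; m'; n']).
Qed.

(** * The components *)

Definition component (i : 'I_7) : sc -> Prop := zclosure (sorbit (Rk i)).

Lemma psi_even i p : even_sc (psi i p).
Proof. by case: (psi_perm i p). Qed.

Lemma sorbit_img i : subsetS (sorbit (Rk i)) (img (psi i)).
Proof. by move=> c /sorbit_sep[p [-> _]]; exists p. Qed.

Lemma img_even i c : img (psi i) c -> even_sc c.
Proof. by move=> [p ->]; exact: psi_even. Qed.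

Lemma sorbit_even i c : sorbit (Rk i) c -> even_sc c.
Proof. by move=> /sorbit_img /img_even. Qed.

(** A nonzero value of [sep i] puts a family member in the orbit, where g = 0. So the product of the
    two vanishes on the parameter space, and [sep i] is nonzero at R_i. *)
Lemma vanishes_sorbit i g : polyfun g -> vanishes (sorbit (Rk i)) g -> vanishes (img (psi i)) g.
Proof.
move=> pg g0 _ [p ->].
have [q [qE [x [y nz]]]] := sorbit_sep (sorbit_refl (Rk i)).
have [q0||] := polyon_domain (polyfun_family (psi_family i) (sep_poly i x y))
                 (polyfun_family (psi_family i) pg).
- case: (eqVneq (sep i x y (psi i q0)) 0) => [->|nzq]; first by rewrite mul0r.
  by rewrite g0 ?mulr0 //; apply: sep_sorbit nzq.
- by move=> h; rewrite qE h eqxx in nz.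
- exact.
Qed.

Lemma component_img i : eqsetS (component i) (zclosure (img (psi i))).
Proof.
move=> c; rewrite /component !zclosureP; [|exact: img_even|exact: sorbit_even].
split=> -[ec vc]; split=> // f pf f0; apply: vc => //.
  by move=> d /sorbit_img; apply: f0.
exact: vanishes_sorbit.
Qed.

Lemma img_component i : subsetS (img (psi i)) (component i).
Proof. by move=> c /sub_zclosure /component_img. Qed.

Lemma component_closed i : zclosed (component i).
Proof. exact: zclosure_closed (@sorbit_even i). Qed.

Lemma component_irreducible i : irreducible (component i).
Proof.
apply: (irreducible_eqset (component_img i)); apply: irreducible_zclosure.
by apply: irreducible_img; [exact: psi_family|exact: psi_even].
Qed.

Lemma component_perm i : subsetS (component i) permVar.
Proof.
apply: zclosure_min; first exact: permVar_closed.
by move=> c /sorbit_img[p ->]; exact: psi_perm.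
Qed.

Definition bad (i : 'I_7) (c : sc) : Prop := even_sc c /\ forall x y, sep i x y c = 0.

Lemma bad_closed i : zclosed (bad i).
Proof.
exists (fun f => exists x y, f = sep i x y); split=> [f [x [y ->]]|c].
  exact: sep_poly.
split=> -[ec bc]; split=> //; first by move=> f [x [y ->]].
by move=> x y; apply: bc; exists x, y.
Qed.

(** By the covering c lies in some family j, and a nonzero [sep i] forces j = i. *)
Lemma sorbit_badP i c : permVar c -> sorbit (Rk i) c <-> ~ bad i c.
Proof.
move=> pc; split=> [/sorbit_sep[_ [_ [x [y nz]]]] [_ /(_ x y) z]|nb].
  by rewrite z eqxx in nz.
have [j [p cE]] := perm_cover pc; rewrite cE in nb *.
have [x [y nz]] : exists x y, sep i x y (psi j p) != 0.
  apply: contrapT => h; apply: nb; split; first exact: psi_even.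
  move=> x y; apply/eqP; apply: contraT => nz.
  by case: h; exists x, y.
have ij : i = j by apply/eqP; apply: contraT => ij; rewrite sep_psi ?eqxx in nz.
by rewrite -ij in nz *; apply: sep_sorbit nz.
Qed.

(** For j distinct from i, [sep i] vanishes on family j and hence on its closure, but not at R_i. *)
Lemma Rk_component i j : component j (Rk i) -> i = j.
Proof.
move=> cj; apply/eqP; apply: contraT => ij.
have [_ [_ [x [y /eqP nz]]]] := sorbit_sep (sorbit_refl (Rk i)); case: nz.
have /component_img := cj; rewrite zclosureP; last exact: img_even.
by case=> _ vc; apply: (vc (sep i x y)); [exact: sep_poly|move=> c [p ->]; apply: sep_psi].
Qed.

Lemma Rk_in_component i : component i (Rk i).
Proof. by apply: sub_zclosure; apply: sorbit_refl. Qed.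

Lemma component_inj i j : subsetS (component i) (component j) -> i = j.
Proof. by move=> /(_ _ (@Rk_in_component i)) /Rk_component. Qed.

(** Otherwise each component has an equation not vanishing on Y; by the covering their product
    vanishes on Y, against primality. *)
Lemma irreducible_component Y : irreducible Y -> subsetS Y permVar ->
  exists i, subsetS Y (component i).
Proof.
move=> irr sub; apply: contrapT => /forallNP no.
have eY c : Y c -> even_sc c by move=> /sub[].
have sepf i : exists f, [/\ polyfun f, vanishes (component i) f & ~ vanishes Y f].
  have [F [pF cF]] := component_closed i.
  have /existsNP[c /not_implyP[Yc]] := no i.
  rewrite cF => /not_andP[/(_ (eY c Yc))//|/existsNP[f /not_implyP[Ff fc]]].
  exists f; split; [exact: pF| |by move=> /(_ c Yc)].
  by move=> d cd; have [_ vd] := proj1 (cF d) cd; apply: vd.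
have [F HF] := fin_all_exists sepf.
have [|i vi] := @irreducible_vanishes_prod _ (enum 'I_7) F Y irr eY (fun i => let: And3 h _ _ := HF i in h).
  move=> c /sub /perm_cover[i ci]; rewrite (bigD1_seq i) ?mem_enum ?enum_uniq //=.
  by have [_ v _] := HF i; rewrite (v c (img_component ci)) mul0r.
by have [_ _] := HF i.
Qed.

Lemma component_irr_component i : irr_component permVar (component i).
Proof.
split; first exact: component_closed.
split; first exact: component_irreducible.
split; first exact: component_perm.
move=> Y irr sub subi; have [j subj] := irreducible_component irr sub.
suff -> : i = j by [].
by apply: component_inj => c /subi /subj.
Qed.

Lemma irr_componentP Y : irr_component permVar Y <-> exists i, eqsetS Y (component i).
Proof.
split=> [[_ [irr [sub max]]]|[i /(fun h c => propext (h c))/funext ->]]; last first.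
  exact: component_irr_component.
have [i subi] := irreducible_component irr sub; exists i => c; split; first exact: subi.
by apply: max => //; [exact: component_irreducible|exact: component_perm].
Qed.

(** * The dimension *)

Lemma component_chain5 i : ~ irr_chain (component i) 5.
Proof.
apply: (no_long_chain (phi_family i)) => g pg g0 c /component_img.
rewrite zclosureP; last exact: img_even.
by case=> _ vc; apply: vc => //; apply: phi_dense.
Qed.

Lemma irr_chain_krull_dim Y n : irr_chain Y 0 -> ~ irr_chain Y n.+1 ->
  exists m, (m <= n)%N /\ krull_dim Y m.
Proof.
move=> Y0; elim: n => [|n IH] Yn; first by exists 0%N.
case: (pselect (irr_chain Y n.+1)) => [h|/IH[m [mn km]]]; first by exists n.+1.
by exists m; rewrite leqW.
Qed.

Lemma component_krull_dim i : exists m, (m <= 4)%N /\ krull_dim (component i) m.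
Proof.
apply: irr_chain_krull_dim (@component_chain5 i); exists (fun=> component i); split=> // j _.
split; first exact: component_closed.
by split; first exact: component_irreducible.
Qed.

(** The free coordinates of [ff_sc] at q = (1, 0). Freeing the first k = 0, 1, 2, 3 of them gives
    linear subspaces in the closure of the orbit of [R10]; the closure itself completes a chain of
    length 4. *)
Definition flag_coords (k : nat) : seq ('I_3 * 'I_3 * 'I_3) :=
  take k [:: (o0, o0, o0); (o0, o0, o1); (o2, o2, o1)].

Definition flag (k : nat) (c : sc) : Prop :=
  forall i j l, (i, j, l) \notin flag_coords k -> c i j l = 0.

Definition flag_sc (k : nat) (p : nat -> C) : sc := fun i j l =>
  if (i, j, l) \in flag_coords k then p (index (i, j, l) (flag_coords k)) else 0.

Lemma flag_img k : eqsetS (flag k) (img (flag_sc k)).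
Proof.
move=> c; split=> [fc|[p ->] i j l]; last by rewrite /flag_sc => /negbTE->.
exists (fun n => let: (i, j, l) := nth (o0, o0, o0) (flag_coords k) n in c i j l).
apply: sc_ext => i j l; rewrite /flag_sc; case: ifP => [h|/negbT/fc//].
by rewrite nth_index.
Qed.

Lemma flag_even k c : flag k c -> even_sc c.
Proof.
move=> fc i j l ne; apply: fc; apply: contra ne => /mem_take.
by rewrite !inE => /or3P[] /eqP[-> -> ->].
Qed.

Lemma flag_closed k : zclosed (flag k).
Proof.
exists (fun f => exists i j l, (i, j, l) \notin flag_coords k /\ f = (fun c => c i j l)).
split=> [f [i [j [l [_ ->]]]]|c]; first exact: pf_coord.
split=> [fc|[_ vc] i j l h]; last by apply: (vc (fun c => c i j l)); exists i, j, l.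
by split=> [|f [i [j [l [h ->]]]]]; [exact: (@flag_even k c fc)|exact: fc].
Qed.

Lemma flag_irreducible k : irreducible (flag k).
Proof.
apply: (irreducible_eqset (@flag_img k)); apply: irreducible_img.
  move=> i j l; rewrite /flag_sc; case: ((i, j, l) \in _); [exact: po_coord|exact: po_const].
by move=> p; apply: (@flag_even k); apply/flag_img; exists p.
Qed.

Lemma flag_component k : subsetS (flag k) (component (@Ordinal 7 3 isT)).
Proof.
move=> c fc; apply: img_component.
exists (nth 0 [:: 1; 0; c o0 o0 o0; c o0 o0 o1; - c o2 o2 o1]); rewrite /psi /=.
have z i j l : (i, j, l) \notin [:: (o0, o0, o0); (o0, o0, o1); (o2, o2, o1)] -> c i j l = 0.
  by move=> h; apply: fc; apply: contra h; apply: mem_take.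
apply: sc_ext; elim/ord3P; elim/ord3P; elim/ord3P; rewrite /ff_sc /mk /=.
all: rewrite ?(mul1r, mul0r, mulr0, mulr1, opprK) //; apply: z => //.
Qed.

Lemma component_chain4 : irr_chain (component (@Ordinal 7 3 isT)) 4.
Proof.
exists (fun k => if (k < 4)%N then flag k else component (@Ordinal 7 3 isT)); split=> k lek.
  case: ifP => _; first by split; [exact: flag_closed|split; [exact: flag_irreducible|exact: flag_component]].
  by split; [exact: component_closed|split; [exact: component_irreducible|]].
rewrite lek ltnS; case: ltnP => k3; split.
- move=> c fc i j l h; apply: fc; apply: contra h.
  rewrite /flag_coords (take_nth (o0, o0, o0)) ?mem_rcons ?inE // => ->.
  by rewrite orbT.
- pose x := nth (o0, o0, o0) [:: (o0, o0, o0); (o0, o0, o1); (o2, o2, o1)] k.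
  move=> /(_ (fun i j l => if (i, j, l) == x then 1 else 0)) h.
  have : flag k.+1 (fun i j l => if (i, j, l) == x then 1 else 0).
    move=> i j l nin; case: eqP => // e; case/negP: nin.
    by rewrite e /flag_coords (take_nth (o0, o0, o0)) // mem_rcons inE eqxx.
  move=> /h /(_ x.1.1 x.1.2 x.2); rewrite -!surjective_pairing eqxx => h1.
  have nin : x \notin flag_coords k by rewrite /x; case: (k) k3 => [|[|[|//]]].
  by have /eqP := h1 nin; rewrite oner_eq0.
- exact: flag_component.
(* Here q = (1, 1), so e1 e2 is nonzero, which fails on the flag. *)
- move=> /(_ (psi (@Ordinal 7 3 isT) (fun=> 1))) h.
  have /h /(_ o0 o1 o0) : component (@Ordinal 7 3 isT) (psi (@Ordinal 7 3 isT) (fun=> 1)).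
    by apply: img_component; exists (fun=> 1).
  have -> : k = 3%N by apply/eqP; rewrite eqn_leq k3 andbT.
  by rewrite /psi /ff_sc /mk /= !mulr1 => /(_ isT)/eqP; rewrite oner_eq0.
Qed.

(** * Rigidity and the final statement *)

(** By the covering c lies in some component i. If the orbit of c is open with complement Z, then Z
    cannot contain the orbit of R_i, whose closure contains c; so the two orbits meet and coincide.
    Conversely [bad i] is the complement. *)
Lemma rigidP c : rigid permVar c <-> exists i, sorbit (Rk i) c.
Proof.
split=> [[pc [Z [cZ cO]]]|[i ic]].
  have [i ci] := perm_cover pc; exists i.
  have [d [id nZ]] : exists d, sorbit (Rk i) d /\ ~ Z d.
    apply: contrapT => /forallNP no.
    have subZ : subsetS (sorbit (Rk i)) Z.
      by move=> d id; apply: contrapT => nZ; apply: (no d).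
    have Zc : Z c by apply: (zclosure_min cZ subZ); exact: img_component.
    by have [_] := proj2 (cO c) (conj pc Zc); apply; apply: sorbit_refl.
  have pd : permVar d by case/sorbit_img: id => p ->; exact: psi_perm.
  have cd : sorbit c d.
    by apply: contrapT => ncd; case: (proj1 (cO d) (conj pd ncd)).
  by apply: (sorbit_trans id); apply: sorbit_sym.
have pc : permVar c by case/sorbit_img: ic => p ->; exact: psi_perm.
split=> //; exists (bad i); split; first exact: bad_closed.
move=> d; split=> -[pd h]; split=> //.
  apply: contrapT => /(sorbit_badP _ pd) idd.
  by apply: h; apply: (sorbit_trans (sorbit_sym ic)).
by move=> /(sorbit_trans ic) /(sorbit_badP _ pd).
Qed.

Theorem mainTheorem6 :
  (* the variety has dimension 4 *)
  var_dim permVar 4 /\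
  (* its irreducible components are exactly the 7 sorbit closures *)
  (forall Y, irr_component permVar Y <->
     exists i : 'I_7, eqsetS Y (zclosure (sorbit (Rk i)))) /\
  (* the 7 components are pairwise distinct *)
  (forall i j : 'I_7, eqsetS (zclosure (sorbit (Rk i))) (zclosure (sorbit (Rk j))) -> i = j) /\
  (* the rigid superalgebras are exactly those isomorphic to one of the 7 *)
  (forall c, rigid permVar c <-> exists i : 'I_7, sorbit (Rk i) c) /\
  (* and the 7 are pairwise non-isomorphic *)
  (forall i j : 'I_7, sorbit (Rk i) (Rk j) -> i = j).
Proof.
split; last split; last split; last split.
- split; last first.
    exists (component (@Ordinal 7 3 isT)); split; first exact: component_irr_component.
    by split; [exact: component_chain4|exact: component_chain5].
  move=> Y /irr_componentP[i /(fun h c => propext (h c))/funext ->].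
  exact: component_krull_dim.
- exact: irr_componentP.
- by move=> i j ij; apply: component_inj => c /ij.
- exact: rigidP.
- by move=> i j /sub_zclosure /Rk_component.
Qed.
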